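(* For each $G\in\mathcal F$, both $I_G^+$ and $I_G$ are homeomorphic to the Lelek fan, and both $(I_G^+,\sigma_G^+)$ and $(I_G,\sigma_G)$ have the specification property.
   Context: $I=[0,1]$. $\mathcal A$ is the collection of all finite sets $A=\{a_1,\ldots,a_k\}$ of positive real numbers with $k\ge3$, $a_1=3$, $a_2=1$, $a_3=\tfrac12$, and $\tfrac13\le a_i\le 3$ for all $i$. For $A\in\mathcal A$, $F_A=\{(x,y)\in I^2: y=ax\text{ for some }a\in A\}$, and $\mathcal F=\{F_A:A\in\mathcal A\}$. For a closed relation $G\subseteq I\times I$: $I_G^+=\{(x_1,x_2,\ldots)\in I^{\mathbb N}: (x_i,x_{i+1})\in G\ \forall i\ge 1\}$ with shift $\sigma_G^+(x_1,x_2,\ldots)=(x_2,x_3,\ldots)$; $I_G=\{(x_i)_{i\in\mathbb Z}\in I^{\mathbb Z}: (x_i,x_{i+1})\in G\ \forall i\in\mathbb Z\}$ with shift $(\sigma_G(\mathbf x))_i=x_{i+1}$. The metrics are $D(\mathbf x,\mathbf y)=\sup_{i\ge 1}|x_i-y_i|/2^{i}$ on $I_G^+$ and $\sup_{i\in\mathbb Z}|x_i-y_i|/2^{|i|}$ on $I_G$ (inducing the product topology). A fan is an arcwise connected, hereditarily unicoherent continuum (nonempty compact connected metric space) with exactly one ramification point (its top $v$). It is smooth if whenever $x_n\to x$, the unique arcs from $v$ to $x_n$ converge in the Hausdorff metric to the unique arc from $v$ to $x$. An endpoint is a point that is an endpoint of every arc containing it. The Lelek fan is the (unique up to homeomorphism)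 smooth fan whose set of endpoints is dense. Let $(Y,f)$ be a dynamical system ($Y$ compact metric with metric $d$, $f:Y\to Y$ continuous). A specification consists of $n\ge1$, points $x_1,\ldots,x_n\in Y$, and non-negative integers $k_j\le \ell_j$ ($1\le j\le n$). It is $N$-spaced if $k_{j+1}-\ell_j\ge N$ for $1\le j\le n-1$. It is $\varepsilon$-traced by $y\in Y$ if $d(f^j(y),f^j(x_i))\le\varepsilon$ for all $1\le i\le n$ and $k_i\le j\le \ell_i$. $(Y,f)$ has the specification property if for each $\varepsilon>0$ there is a positive integer $N$ such that every $N$-spaced specification is $\varepsilon$-traced by some $y\in Y$. *)

(* Defs.v *)
From HB Require Import structures.
From mathcomp Require Import all_boot all_order all_algebra.
From mathcomp Require Import all_classical all_reals all_analysis.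
From mathcomp Require Import ring lra.
Set Implicit Arguments.
Unset Strict Implicit.
Unset Printing Implicit Defensive.
Import Order.TTheory GRing.Theory Num.Theory.
Import numFieldNormedType.Exports.

Local Open Scope classical_set_scope.
Local Open Scope ring_scope.

Definition homeomorphic (X Y : topologicalType) : Prop :=
  exists (f : X -> Y) (g : Y -> X),
    [/\ continuous f, continuous g, cancel f g & cancel g f].

Section continua.
Context {R : realType} {X : metricType R}.
Implicit Types (A B K : set X) (a b v x : X).

(* [K] is a continuum, as a subspace of [X]; one-point sets are continua *)
Definition continuum K : Prop := [/\ K !=set0, compact K & connected K].

(* [f] and [g] are mutually inverse homeomorphisms between [0,1] and [A] *)
Definition is_arc A a b : Prop :=
  exists (f : R -> X) (g : X -> R),
    [/\ {within `[0, 1], continuous f}, {within A, continuous g},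
        f @` `[0, 1] = A & {in `[0, 1], cancel f g}] /\ f 0 = a /\ f 1 = b.

(* the arc from [a] to [b], with the convention that it is {a} if [a = b] *)
Definition arc_or_point A a b : Prop := is_arc A a b \/ (a = b /\ A = [set a]).

Definition unicoherent K : Prop :=
  forall A B, continuum A -> continuum B -> A `|` B = K -> connected (A `&` B).

Definition is_endpoint x : Prop :=
  forall A a b, is_arc A a b -> A x -> x = a \/ x = b.

(* [x] is the top of a simple triod *)
Definition ramification_point x : Prop :=
  exists A B C a b c,
    [/\ is_arc A x a, is_arc B x b & is_arc C x c] /\
    [/\ A `&` B = [set x], B `&` C = [set x] & A `&` C = [set x]].

Definition hausdorff_dist A B : R :=
  inf [set e | [/\ 0 < e,
                   forall a, A a -> exists2 b, B b & mdist a b < e &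
                   forall b, B b -> exists2 a, A a & mdist b a < e]].

End continua.

Section fans.
Context {R : realType}.
Implicit Type X : metricType R.

Definition arcwise_connected X : Prop :=
  forall a b : X, a <> b -> exists A, is_arc A a b.

Definition hereditarily_unicoherent X : Prop :=
  forall K : set X, continuum K -> unicoherent K.

Definition is_fan X (v : X) : Prop :=
  [/\ continuum [set: X], arcwise_connected X, hereditarily_unicoherent X &
      forall x : X, ramification_point x <-> x = v].

(* In a fan, arcs between two given points exist and are unique, so that
   [A_ n] and [A] below are determined by [x_ n] and [x]. *)
Definition smooth_at X (v : X) : Prop :=
  forall (x_ : nat -> X) (x : X), x_ n @[n --> \oo] --> x ->
  forall (A_ : nat -> set X) (A : set X),
    (forall n, arc_or_point (A_ n) v (x_ n)) -> arc_or_point A v x ->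
    hausdorff_dist (A_ n) A @[n --> \oo] --> (0 : R).

Definition Lelek_fan X : Prop :=
  exists v : X, [/\ is_fan v, smooth_at v & dense [set x : X | is_endpoint x]].

(* All Lelek fans are homeomorphic, hence "the" Lelek fan. *)
Definition homeomorphic_to_Lelek_fan X : Prop :=
  exists L : metricType R, Lelek_fan L /\ homeomorphic X L.

End fans.

Section specification.
Context {R : realType} (Y : metricType R) (f : Y -> Y).
Local Open Scope nat_scope.

Definition dynamical_system : Prop := compact [set: Y] /\ continuous f.

(* A specification consists of [x i], [k i], [l i] for [i < n]; the values for
   [i >= n] are irrelevant. *)
Definition is_specification (n : nat) (x : nat -> Y) (k l : nat -> nat) : Prop :=
  1 <= n /\ forall i, i < n -> k i <= l i.

Definition spaced (N n : nat) (k l : nat -> nat) : Prop :=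
  forall i, i.+1 < n -> l i + N <= k i.+1.

Definition traced (eps : R) (n : nat) (x : nat -> Y) (k l : nat -> nat)
    (y : Y) : Prop :=
  forall i j, i < n -> k i <= j <= l i ->
    (mdist (iter j f y) (iter j f (x i)) <= eps)%R.

Definition specification_property : Prop :=
  dynamical_system /\
  forall eps : R, (0 < eps)%R -> exists2 N : nat, 0 < N &
    forall n x k l, is_specification n x k l -> spaced N n k l ->
      exists y, traced eps n x k l y.

End specification.

Section relations.
Context {R : realType}.
Implicit Type G : set (R * R).

Definition calA (A : set R) : Prop :=
  exists2 s : seq R, A = [set` [:: 3, 1, 2^-1 & s]] &
    forall a, A a -> 0 < a /\ 3^-1 <= a <= 3.

Definition F_ (A : set R) : set (R * R) :=
  [set p | 0 <= p.1 <= 1 /\ 0 <= p.2 <= 1 /\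
           exists2 a, A a & p.2 = a * p.1].

Definition calF : set (set (R * R)) := F_ @` calA.

(* the sequence (x_1, x_2, ...) is represented by [fun i : nat => x_(i+1)] *)
Record fwd_space G := FwdPoint {
  fwd_val :> nat -> R;
  fwd_I : forall i, 0 <= fwd_val i <= 1;
  fwd_G : forall i, G (fwd_val i, fwd_val i.+1) }.

Record bi_space G := BiPoint {
  bi_val :> int -> R;
  bi_I : forall i, 0 <= bi_val i <= 1;
  bi_G : forall i, G (bi_val i, bi_val (i + 1)) }.

HB.instance Definition _ G := gen_eqMixin (fwd_space G).
HB.instance Definition _ G := gen_choiceMixin (fwd_space G).
HB.instance Definition _ G := gen_eqMixin (bi_space G).
HB.instance Definition _ G := gen_choiceMixin (bi_space G).

Lemma fwd_inj G (x y : fwd_space G) : (forall i, x i = y i) -> x = y.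
Proof.
case: x y => [x xI xG] [y yI yG] /= /funext exy; case: _ / exy in yI yG *.
by congr FwdPoint; exact: Prop_irrelevance.
Qed.

Lemma bi_inj G (x y : bi_space G) : (forall i, x i = y i) -> x = y.
Proof.
case: x y => [x xI xG] [y yI yG] /= /funext exy; case: _ / exy in yI yG *.
by congr BiPoint; exact: Prop_irrelevance.
Qed.

Definition sup_dist (T : Type) (e : T -> nat) (x y : T -> R) : R :=
  sup [set `|x i - y i| / 2 ^+ e i | i in [set: T]].

Section sup_dist.
Variables (T : Type) (i0 : T) (e : T -> nat).
Implicit Types x y z : T -> R.
Let I x := forall i, 0 <= x i <= 1.

Lemma sup_dist_ub x y i : I x -> I y ->
  `|x i - y i| / 2 ^+ e i <= sup_dist e x y.
Proof.
move=> xI yI; apply: ub_le_sup; last by exists i.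
exists 1 => _ [j _ <-].
rewrite ler_pdivrMr ?exprn_gt0// mul1r (@le_trans _ _ 1)//.
  by have := xI j; have := yI j; rewrite ler_norml; lra.
by rewrite exprn_ege1// ler1n.
Qed.

Lemma sup_dist_le x y c :
  (forall i, `|x i - y i| / 2 ^+ e i <= c) -> sup_dist e x y <= c.
Proof.
move=> h; apply: ge_sup; first by exists (`|x i0 - y i0| / 2 ^+ e i0), i0.
by move=> _ [i _ <-].
Qed.

Lemma sup_distxx x : I x -> sup_dist e x x = 0.
Proof.
move=> xI; apply/eqP; rewrite eq_le; apply/andP; split.
  by apply: sup_dist_le => i; rewrite subrr normr0 mul0r.
by apply: le_trans (sup_dist_ub i0 xI xI); rewrite subrr normr0 mul0r.
Qed.

Lemma sup_dist_eq0 x y : I x -> I y -> sup_dist e x y = 0 ->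
  forall i, x i = y i.
Proof.
move=> xI yI h i; have := sup_dist_ub i xI yI.
rewrite h ler_pdivrMr ?exprn_gt0// mul0r normr_le0 subr_eq0.
by move/eqP.
Qed.

Lemma sup_dist_sym x y : sup_dist e x y = sup_dist e y x.
Proof. by congr sup; apply: eq_imagel => i _; rewrite distrC. Qed.

Lemma sup_dist_triangle y x z : I x -> I y -> I z ->
  sup_dist e x z <= sup_dist e x y + sup_dist e y z.
Proof.
move=> xI yI zI; apply: sup_dist_le => i.
apply: le_trans (lerD (sup_dist_ub i xI yI) (sup_dist_ub i yI zI)).
by rewrite -mulrDl ler_pM2r ?invr_gt0 ?exprn_gt0// ler_distD.
Qed.

End sup_dist.

Definition fwd_dist G (x y : fwd_space G) : R :=
  sup_dist (fun i : nat => i.+1) x y.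

Definition bi_dist G (x y : bi_space G) : R :=
  sup_dist (fun i : int => `|i|%N) x y.

Section metrics.
Variable G : set (R * R).

Let fwd_distxx (x : fwd_space G) : fwd_dist x x = 0.
Proof. exact: (sup_distxx 0%N _ (fwd_I x)). Qed.
Let fwd_dist_eq0 (x y : fwd_space G) : fwd_dist x y = 0 -> x = y.
Proof. by move/(sup_dist_eq0 (fwd_I x) (fwd_I y))/fwd_inj. Qed.
Let fwd_dist_sym (x y : fwd_space G) : fwd_dist x y = fwd_dist y x.
Proof. exact: sup_dist_sym. Qed.
Let fwd_dist_triangle (y x z : fwd_space G) :
  fwd_dist x z <= fwd_dist x y + fwd_dist y z.
Proof. exact: (sup_dist_triangle 0 _ (fwd_I x) (fwd_I y) (fwd_I z)). Qed.

HB.instance Definition _ := @isMetric.Build R (fwd_space G) (@fwd_dist G)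
  fwd_distxx fwd_dist_eq0 fwd_dist_sym fwd_dist_triangle.

Let bi_distxx (x : bi_space G) : bi_dist x x = 0.
Proof. exact: (sup_distxx 0 _ (bi_I x)). Qed.
Let bi_dist_eq0 (x y : bi_space G) : bi_dist x y = 0 -> x = y.
Proof. by move/(sup_dist_eq0 (bi_I x) (bi_I y))/bi_inj. Qed.
Let bi_dist_sym (x y : bi_space G) : bi_dist x y = bi_dist y x.
Proof. exact: sup_dist_sym. Qed.
Let bi_dist_triangle (y x z : bi_space G) :
  bi_dist x z <= bi_dist x y + bi_dist y z.
Proof. exact: (sup_dist_triangle 0 _ (bi_I x) (bi_I y) (bi_I z)). Qed.

HB.instance Definition _ := @isMetric.Build R (bi_space G) (@bi_dist G)
  bi_distxx bi_dist_eq0 bi_dist_sym bi_dist_triangle.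

End metrics.

Definition fwd_shift G (x : fwd_space G) : fwd_space G :=
  FwdPoint (fun i => fwd_I x i.+1) (fun i => fwd_G x i.+1).

Definition bi_shift G (x : bi_space G) : bi_space G :=
  BiPoint (fun i => bi_I x (i + 1)) (fun i => bi_G x (i + 1)).

End relations.

(* Main.v *)
(* A nonzero point of either space is determined by one coordinate and its
   sequence of multipliers, so the space is a union of legs, one for each
   multiplier sequence with bounded products, that meet at the constant sequence 0.
   As there are finitely many multipliers, the legs are separated by sets that are
   open and closed away from the top; hence a continuum that avoids the top lies in
   one leg, and a continuum contains the part of a leg between any two of its
   points.  All properties of a smooth fan follow from these two facts, and a point
   with a coordinate equal to 1 is an endpoint because it is at the end of its leg.

   The numbers 3^m/2^n are dense in the positive reals.  So every value can be
   moved, by steps of ratio 3 and 1/2, to any other value up to a factor close to 1,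
   within a number of steps that is uniform as long as the values stay away from 0.
   This shows that endpoints are dense, and it also allows one path to trace a whole
   specification: small values at the ends of a block are first replaced by a
   constant, and consecutive blocks, the second one slightly scaled down, are then
   connected. *)
Require Import Defs.
From mathcomp Require Import all_boot all_order all_algebra.
From mathcomp Require Import all_classical all_reals all_analysis.
From mathcomp Require Import zify ring lra.
Set Implicit Arguments.
Unset Strict Implicit.
Unset Printing Implicit Defensive.
Import Order.TTheory GRing.Theory Num.Theory.
Import numFieldNormedType.Exports.

Local Open Scope classical_set_scope.
Local Open Scope ring_scope.

(** * Density of the numbers 3^m / 2^n *)

Section powers_of_three_and_two.
Variable R : realType.
Implicit Types (q r eps : R) (m n : nat).

Lemma expr_unbounded q r : 1 < q -> exists n, r <= q ^+ n.
Proof.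
move=> q1; have q10 : 0 < q - 1 by rewrite subr_gt0.
have bern n : 1 + n%:R * (q - 1) <= q ^+ n.
  elim: n => [|n IH]; first by rewrite mul0r addr0 expr0.
  rewrite exprS -natr1; have n0 : 0 <= n%:R :> R by [].
  have := ler_wpM2l (ltW (lt_trans ltr01 q1)) IH.
  by have := mulr_ge0 n0 (sqr_ge0 (q - 1)); rewrite expr2; lra.
exists (Num.truncn (`|r| / (q - 1))).+1; apply: le_trans (bern _).
have /truncn_itv/andP[_] : 0 <= `|r| / (q - 1) by rewrite divr_ge0// ltW.
rewrite ltr_pdivrMr// => /ltW h; apply: le_trans (ler_norm r) _.
by apply: le_trans h _; rewrite lerDr.
Qed.

(** By parity: a power of 3 is odd, so [n] would be 0, and then [m] as well. *)
Lemma exp3_neq_exp2 m n : (0 < m)%N -> (3 ^ m <> 2 ^ n)%N.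
Proof.
move=> m0 e; have := oddX 3 m; rewrite e oddX orbT orbF => /eqP n0.
move: e; rewrite n0 => /eqP; rewrite expn0 -[X in _ == X](expn0 3).
by rewrite eqn_exp2l// => /eqP m00; rewrite m00 in m0.
Qed.

(** Pigeonhole. Dividing 3^k by the largest power of 2 not above it gives a value in [1, 2); among N
    + 1 such values, two lie in the same cell of length 1/N, and their quotient is the required
    ratio. *)
Lemma pow_ratio_near1 eps : 0 < eps ->
  exists a b, 3 ^+ a / 2 ^+ b != 1 :> R /\ `|3 ^+ a / 2 ^+ b - 1 : R| < eps.
Proof.
move=> eps0; pose N := (Num.truncn eps^-1).+1.
have N0 : 0 < N%:R :> R by [].
have Neps : N%:R^-1 < eps.
  rewrite -[ltRHS]invrK ltf_pV2 ?posrE ?invr_gt0//.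
  by have /truncn_itv/andP[] : 0 <= eps^-1 by rewrite invr_ge0 ltW.
pose e k := trunc_log 2 (3 ^ k); pose f k : R := 3 ^+ k / 2 ^+ e k.
have f12 k : 1 <= f k < 2.
  have p2 : 0 < 2 ^+ e k :> R by rewrite exprn_gt0.
  have [lo hi] : (2 ^ e k <= 3 ^ k)%N /\ (3 ^ k < 2 ^ (e k).+1)%N.
    by split; [apply: trunc_logP; rewrite ?expn_gt0|apply: trunc_log_ltn].
  rewrite /f ler_pdivlMr// mul1r ltr_pdivrMr// -exprS -!natrX.
  by rewrite ler_nat ltr_nat lo hi.
have cellP k : (Num.truncn (N%:R * (f k - 1)) < N)%N.
  have /andP[f1 f2] := f12 k.
  rewrite truncn_lt_nat; last by rewrite mulr_ge0// subr_ge0.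
  by rewrite -[ltRHS]mulr1 ltr_pM2l//; lra.
pose cell (k : 'I_N.+1) := Ordinal (cellP k).
have /injectivePn[k [l kl ckl]] : ~~ injectiveb cell.
  apply/negP => /injectiveP/leq_card; rewrite !card_ord; lia.
wlog lt_kl : k l kl ckl / (k < l)%N.
  move=> H; case: (ltngtP k l) => [|lk|e']; first exact: H.
    by apply: (H l k) => //; rewrite eq_sym.
  by move: kl; rewrite (ord_inj e') eqxx.
have /andP[fk1 fk2] := f12 k; have /andP[fl1 fl2] := f12 l.
have ekl : (e k <= e l)%N.
  by apply: leq_trunc_log; rewrite leq_exp2l// ltnW.
have fkl : 3 ^+ (l - k) / 2 ^+ (e l - e k) = f l / f k.
  have -> : f l = 3 ^+ (l - k + k) / 2 ^+ (e l - e k + e k).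
    by rewrite !subnK// ltnW.
  by rewrite /f !exprD; field; rewrite !expf_neq0.
exists (l - k)%N, (e l - e k)%N; split.
  apply/eqP => /(congr1 ( *%R^~ (2 ^+ (e l - e k)))).
  rewrite divfK ?expf_neq0// mul1r -!natrX => /eqP; rewrite eqr_nat => /eqP.
  by apply: exp3_neq_exp2; rewrite subn_gt0.
have close : `|f l - f k| < N%:R^-1.
  have /(congr1 val) /= := ckl.
  have /truncn_itv/andP[a1 a2] : 0 <= N%:R * (f k - 1).
    by rewrite mulr_ge0// subr_ge0.
  have /truncn_itv/andP[b1 b2] : 0 <= N%:R * (f l - 1).
    by rewrite mulr_ge0// subr_ge0.
  move=> E; rewrite -E -natr1 in b1 b2; rewrite -natr1 in a2.
  rewrite -(ltr_pM2l N0) divff ?gt_eqF// -[X in X * _]gtr0_norm// -normrM.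
  by rewrite ltr_norml; lra.
rewrite fkl -[X in _ - X](@divff _ (f k)); last by rewrite gt_eqF//; lra.
rewrite -mulrBl normrM normfV ltr_pdivrMr; last by rewrite normr_gt0 gt_eqF//; lra.
apply: (lt_trans close); apply: (lt_le_trans Neps).
by rewrite ger0_norm; [nra|lra].
Qed.

Lemma pow_ratio_below1 eps : 0 < eps ->
  exists a b, 1 - eps < 3 ^+ a / 2 ^+ b :> R /\ 3 ^+ a / 2 ^+ b < 1 :> R.
Proof.
move=> eps0; have [a [b [q1 qe]]] := pow_ratio_near1 eps0.
move: q1 qe; set q : R := 3 ^+ a / 2 ^+ b => q1.
rewrite ltr_norml => /andP[qlo qhi].
case: (ltgtP q 1) q1 => // [lt1 _|gt1 _].
  by exists a, b; rewrite -/q; split; [lra|].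
(* If q is slightly above 1, the largest power of q below 2, halved, is
   slightly below 1. *)
have ex2 : exists n, 2 <= q ^+ n by exact: expr_unbounded.
case: (ex_minnP ex2) => -[|k] hk kmin; first by rewrite expr0 in hk; lra.
have lt2 : q ^+ k < 2.
  by rewrite ltNge; apply/negP => /kmin; rewrite ltnn.
have E : 3 ^+ (k * a) / 2 ^+ (k * b).+1 = q ^+ k / 2 :> R.
  rewrite mulnC [(k * b)%N]mulnC exprS !exprM /q expr_div_n invfM mulrA.
  by rewrite mulrAC.
exists (k * a)%N, (k * b).+1; rewrite E; split; last by lra.
have q0 : 0 < q by lra.
rewrite exprS in hk; have := exprn_gt0 k q0; nra.
Qed.

(** The numbers 3^J q^k, with q slightly below 1, descend from at least 1/r0 to at most r0 by
    factors greater than 1 - eps, and the first one not above r is close enough to r. As J and K are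
    chosen before r, the bound N is uniform. *)
Lemma pow_ratio_dense eps r0 : 0 < eps -> 0 < r0 ->
  exists N, forall r, r0 <= r <= r0^-1 -> exists m n,
    (m + n <= N)%N /\ (1 - eps) * r <= 3 ^+ m / 2 ^+ n <= r.
Proof.
move=> eps0 r00; have [a [b [qlo qhi]]] := pow_ratio_below1 eps0.
move: qlo qhi; set q : R := 3 ^+ a / 2 ^+ b => qlo qhi.
have q0 : 0 < q by rewrite divr_gt0// exprn_gt0.
have [J hJ] := @expr_unbounded 3 r0^-1 ltac:(by rewrite ltr1n).
have [K hK] : exists K, 3 ^+ J / r0 <= q^-1 ^+ K.
  by apply: expr_unbounded; rewrite invf_gt1.
have {}hK : 3 ^+ J * q ^+ K <= r0.
  by move: hK; rewrite exprVn ler_pdivrMr// ler_pdivlMl ?exprn_gt0// mulrC.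
exists (J + K * (a + b))%N => r /andP[rlo rhi].
have exk : exists k, 3 ^+ J * q ^+ k <= r by exists K; apply: le_trans rlo.
case: (ex_minnP exk) => k hk kmin.
have kK : (k <= K)%N by apply: kmin; apply: le_trans rlo.
have E : 3 ^+ (J + k * a) / 2 ^+ (k * b) = 3 ^+ J * q ^+ k :> R.
  by rewrite /q exprD mulnC [(k * b)%N]mulnC !exprM expr_div_n mulrA.
exists (J + k * a)%N, (k * b)%N; split.
  by rewrite -addnA leq_add2l -mulnDr leq_mul2r kK orbT.
rewrite E hk andbT; case: k {E} kK hk kmin => [_ hk _|k _ hk kmin].
  have r0' : 0 < r by apply: lt_le_trans rlo.
  rewrite expr0 mulr1; apply: (le_trans _ hJ); apply: le_trans rhi; nra.
have : r < 3 ^+ J * q ^+ k.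
  by rewrite ltNge; apply/negP => /kmin; rewrite ltnn.
have r0' : 0 < r by apply: lt_le_trans rlo.
by rewrite exprS; nra.
Qed.

End powers_of_three_and_two.

(** * Paths of the relation *)

Section paths.
Variables (R : realType) (A : set R).
Hypotheses (A3 : A 3) (A1 : A 1) (A2 : A 2^-1).
Hypothesis A_bounds : forall a, A a -> 3^-1 <= a <= 3.
Implicit Types (p q x : nat -> R) (r s t c eps : R) (m n i j k l : nat).

Definition is_path p :=
  forall i, 0 <= p i <= 1 /\ exists2 a, A a & p i.+1 = a * p i.

Definition glue p m q : nat -> R := fun i => if (i <= m)%N then p i else q (i - m)%N.

Lemma glue_path p m q : is_path p -> is_path q -> q 0%N = p m ->
  is_path (glue p m q).
Proof.
move=> Pp Pq e i; rewrite /glue; split.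
  by case: ifP => _; [case: (Pp i)|case: (Pq (i - m)%N)].
case: (ltngtP i m) => im; first by have [_] := Pp i.
  by rewrite subSn 1?ltnW//; have [_] := Pq (i - m)%N.
by rewrite im subSnn -e; have [_] := Pq 0%N.
Qed.

Lemma glueEl p m q i : (i <= m)%N -> glue p m q i = p i.
Proof. by rewrite /glue => ->. Qed.

Lemma glueEr p m q i : q 0%N = p m -> (m <= i)%N -> glue p m q i = q (i - m)%N.
Proof.
rewrite /glue => e; rewrite leq_eqVlt => /predU1P[<-|mi].
  by rewrite leqnn subnn.
by rewrite leqNgt mi.
Qed.

Lemma cst_path c : 0 <= c <= 1 -> is_path (fun=> c).
Proof. by move=> c01 i; split=> //; exists 1; rewrite ?mul1r. Qed.

Lemma drop_path p k : is_path p -> is_path (fun i => p (k + i)%N).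
Proof. by move=> Pp i; rewrite addnS; exact: Pp. Qed.

Lemma scale_path p c : 0 <= c <= 1 -> is_path p -> is_path (fun i => c * p i).
Proof.
move=> /andP[c0 c1] Pp i; have [/andP[p0 p1] [a Aa ->]] := Pp i; split.
  by rewrite mulr_ge0// mulr_ile1.
by exists a => //; rewrite mulrCA.
Qed.

Lemma path_step_le p i : is_path p -> p i.+1 <= 3 * p i.
Proof.
move=> Pp; have [/andP[p0 _] [a /A_bounds/andP[_ a3] ->]] := Pp i.
exact: ler_wpM2r.
Qed.

Lemma path_step_ge p i : is_path p -> p i <= 3 * p i.+1.
Proof.
move=> Pp; have [/andP[p0 _] [a /A_bounds/andP[a3 _] ->]] := Pp i.
by rewrite mulrA ler_peMl//; lra.
Qed.

(** The end value is held from step [n] on, which the multiplier 1 permits; so [n] is an upper bound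
    for the length of the connection and the time of departure from [t] remains free. *)
Definition reach n s t :=
  exists p, [/\ is_path p, p 0%N = s & forall i, (n <= i)%N -> p i = t].

Lemma reach_refl s : 0 <= s <= 1 -> reach 0 s s.
Proof. by move=> s01; exists (fun=> s); split => //; exact: cst_path. Qed.

Lemma reach_leq n n' s t : (n <= n')%N -> reach n s t -> reach n' s t.
Proof.
move=> nn' [p [Pp p0 pn]]; exists p; split=> // i n'i.
by apply: pn; apply: leq_trans n'i.
Qed.

Lemma reach_step n s t a : A a -> 0 <= a * t <= 1 -> reach n s t ->
  reach n.+1 s (a * t).
Proof.
move=> Aa at01 [p [Pp p0 pn]].
pose q i := if i == 0%N then t else a * t.
have Pq : is_path q.
  move=> [|i]; rewrite /q /=; split => //.
  - by rewrite -(pn n)//; have [] := Pp n.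
  - by exists a.
  - by exists 1; rewrite ?mul1r.
exists (glue p n q); split.
- by apply: glue_path => //; rewrite pn.
- by rewrite glueEl.
- move=> i ni; rewrite glueEr ?pn//; last exact: ltnW.
  by rewrite /q subn_eq0 leqNgt ni.
Qed.

(** All halvings come first and the multiplications by 3 afterwards: the values fall from [s], then
    rise to the final value, and so never exceed 1. *)
Lemma reach_pow m n s : 0 < s <= 1 -> s * (3 ^+ m / 2 ^+ n) <= 1 ->
  reach (m + n) s (s * (3 ^+ m / 2 ^+ n)).
Proof.
move=> s01; have /andP[s0 s1] := s01; elim: m => [|m IH] h.
  rewrite mul1r add0n {h}; elim: n => [|n IH].
    by rewrite invr1 mulr1; apply: reach_refl; rewrite ltW.
  rewrite exprS invfM mulrCA; apply: reach_step => //.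
  rewrite mulr_ge0 ?divr_ge0 ?(ltW s0) ?exprn_ge0//=.
  apply: mulr_ile1; rewrite ?divr_ge0 ?(ltW s0) ?exprn_ge0//; first by lra.
  rewrite ler_pdivrMr ?exprn_gt0// mul1r (le_trans s1)// exprn_ege1//.
  by rewrite ler1n.
have E : s * (3 ^+ m.+1 / 2 ^+ n) = 3 * (s * (3 ^+ m / 2 ^+ n)) :> R.
  by rewrite exprS; ring.
rewrite E in h *; have p0 : 0 < s * (3 ^+ m / 2 ^+ n).
  by rewrite mulr_gt0// divr_gt0// exprn_gt0.
by rewrite addSn; apply: reach_step => //; [lra|apply: IH; lra].
Qed.

(** The ratio t/s lies between s0 and 1/s0 and is approximated from below by 3^m/2^n; [c] is the
    relative error. Approximation from below keeps the target at most 1. *)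
Lemma uniform_reach eps s0 : 0 < eps <= 1 -> 0 < s0 <= 1 -> exists N,
  forall s t, s0 <= s <= 1 -> s0 <= t <= 1 -> exists c,
    1 - eps <= c <= 1 /\ reach N s (c * t).
Proof.
move=> /andP[eps0 eps1] /andP[s00 s01].
have [N hN] := pow_ratio_dense eps0 s00.
exists N => s t /andP[slo shi] /andP[tlo thi].
have spos : 0 < s by apply: lt_le_trans slo.
have tpos : 0 < t by apply: lt_le_trans tlo.
have [|m [n [mnN]]] := hN (t / s).
  rewrite ler_pdivlMr// ler_pdivrMr//; apply/andP; split.
    by apply: le_trans tlo; rewrite ler_piMr// ltW.
  by rewrite (le_trans thi)// mulrC ler_pdivlMr// mul1r.
set q := 3 ^+ m / 2 ^+ n => /andP[qlo qhi].
exists (s * q / t); split.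
  rewrite ler_pdivlMr// ler_pdivrMr// mul1r.
  by move: qlo qhi; rewrite mulrA ler_pdivrMr// ler_pdivlMr// ![q * s]mulrC => -> ->.
rewrite divfK ?gt_eqF//; apply: reach_leq mnN _; apply: reach_pow.
  by rewrite spos.
by move: qhi; rewrite ler_pdivlMr// mulrC => /le_trans; exact.
Qed.

(* Where [x] is below [dl] at the beginning and at the end of the block
   [[K, L]], it is replaced by a constant; steps multiply by at most 3 and at
   least 1/3, so this constant is below [3 * dl]. *)
Lemma block_replacement x dl K L : is_path x -> 0 < dl <= 1 -> (K <= L)%N ->
  exists z, [/\ is_path z,
    forall i, (K <= i <= L)%N -> `|z i - x i| <= 3 * dl,
    forall i, (i <= K)%N -> z i = z K, forall i, (L <= i)%N -> z i = z L &
    dl <= z K /\ dl <= z L].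
Proof.
move=> Px /andP[dl0 dl1] KL.
have x0 i : 0 <= x i by have [/andP[]] := Px i.
case: (pselect (exists j, (K <= j <= L)%N && (dl <= x j))) => [ex|nex]; last first.
  exists (fun=> dl); split => //; first by apply: cst_path; lra.
  move=> i iKL; have : x i < dl.
    by rewrite ltNge; apply/negP => h; apply: nex; exists i; rewrite iKL.
  by have := x0 i; rewrite ler_norml; lra.
case: (ex_minnP ex) => j0 /andP[/andP[Kj0 j0L] xj0] j0min.
have bnd j : (K <= j <= L)%N && (dl <= x j) -> (j <= L)%N.
  by case/andP => /andP[].
case: (ex_maxnP ex bnd) => j1 /andP[/andP[Kj1 j1L] xj1] j1max.
have j01 : (j0 <= j1)%N by apply: j0min; rewrite Kj1 j1L.
(* [z] follows [x] from the first to the last time in the block at which [x] is at least [dl], and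
   is frozen before and after. *)
pose z i := x (maxn j0 (minn i j1)).
have zl i : (i <= j0)%N -> z i = x j0 by move=> ?; congr x; lia.
have zr i : (j1 <= i)%N -> z i = x j1 by move=> ?; congr x; lia.
exists z; split.
- move=> i; split; first by have [] := Px (maxn j0 (minn i j1)).
  case: (leqP j0 i) => ji; last first.
    by exists 1 => //; rewrite mul1r !zl// ltnW.
  case: (ltnP i j1) => ij; last first.
    by exists 1 => //; rewrite mul1r !zr// ltnW.
  have [_ [a Aa E]] := Px i; exists a => //.
  have -> : z i = x i by congr x; lia.
  by rewrite -E; congr x; lia.
- move=> i /andP[Ki iL].
  case: (leqP j0 i) => ji; last first.
    rewrite zl 1?ltnW//.
    have xi : x i < dl.
      rewrite ltNge; apply/negP => h.
      by have := j0min i; rewrite Ki iL h => /(_ isT); lia.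
    (* By minimality of [j0] the preceding value is below [dl], so one step reaches less than 3 *
       dl. *)
    have : x j0.-1 < dl.
      rewrite ltNge; apply/negP => h.
      have := j0min j0.-1; rewrite h; have -> : (K <= j0.-1 <= L)%N by lia.
      by move=> /(_ isT); lia.
    have := path_step_le j0.-1 Px; rewrite prednK; last by lia.
    by have := x0 i; have := x0 j0; rewrite ler_norml; lra.
  case: (leqP i j1) => ij.
    have -> : z i = x i by congr x; lia.
    by rewrite subrr normr0; lra.
  rewrite zr 1?ltnW//.
  have xi : x i < dl.
    rewrite ltNge; apply/negP => h.
    by have := j1max i; rewrite Ki iL h => /(_ isT); lia.
  have : x j1.+1 < dl.
    rewrite ltNge; apply/negP => h.
    have := j1max j1.+1; rewrite h; have -> : (K <= j1.+1 <= L)%N by lia.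
    by move=> /(_ isT); lia.
  have := path_step_ge j1 Px.
  by have := x0 i; have := x0 j1; rewrite ler_norml; lra.
- by move=> i iK; rewrite !zl//; lia.
- by move=> i iL; rewrite !zr//; lia.
- by rewrite zl// zr.
Qed.

Lemma path_specification eps : 0 < eps -> exists N, forall n
    (x : nat -> nat -> R) (k l : nat -> nat),
  (forall i, is_path (x i)) -> (forall i, i < n -> k i <= l i)%N ->
  (forall i, i.+1 < n -> l i + N <= k i.+1)%N ->
  exists2 y, is_path y &
    forall i j, (i < n)%N -> (k i <= j <= l i)%N -> `|y j - x i j| <= eps.
Proof.
(* The error is at most 3 * dl from [block_replacement] plus [dl] from scaling by c >= 1 - dl. The
   bound dl <= 1/2 ensures that a scaled value [c * z], with z >= dl, is still at least dl / 2. *)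
move=> eps0; pose dl := Num.min (eps / 4) 2^-1.
have dl0 : 0 < dl by rewrite lt_min; apply/andP; split; lra.
have dle : 4 * dl <= eps.
  have : dl <= eps / 4 by rewrite ge_min lexx.
  by lra.
have dl2 : dl <= 2^-1 by rewrite ge_min lexx orbT.
have dl01 : 0 < dl <= 1 by lra.
have hdl01 : 0 < dl / 2 <= 1 by lra.
have [N hN] := uniform_reach dl01 hdl01.
exists N => n x k l Px; elim: n => [|n IH] kl gap.
  by exists (fun=> 1) => //; apply: cst_path; rewrite ler01 lexx.
(* The tracing path is moreover kept constant after the last block, at a value
   bounded away from 0, so that the next block can be reached in [N] steps. *)
suff [y [Py ytr _ _]] : exists y, [/\ is_path y,
    forall i j, (i < n.+1)%N -> (k i <= j <= l i)%N -> `|y j - x i j| <= eps,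
    forall j, (l n <= j)%N -> y j = y (l n) & dl / 2 <= y (l n)] by exists y.
elim: n {IH} kl gap => [|n IH] kl gap.
  have [z [Pz zx zK zL [zdl zdl']]] := block_replacement (Px 0%N) dl01 (kl 0%N isT).
  exists z; split=> //; last by lra.
  move=> [|//] j _ /zx; lra.
have [||y [Py ytr yl yldl]] := IH.
- by move=> i iN; apply: kl; rewrite ltnW.
- by move=> i iN; apply: gap; rewrite ltnW.
have gapn : (l n + N <= k n.+1)%N by apply: gap.
have lk : (l n <= k n.+1)%N := leq_trans (leq_addr _ _) gapn.
have Nkl : (N <= k n.+1 - l n)%N by rewrite leq_subRL.
have kl1 : (k n.+1 <= l n.+1)%N by apply: kl.
(* The gaps make [l] increase, so all earlier blocks end by time [l n], up to which the new path
   agrees with [y]. *)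
have lmono i : (i <= n)%N -> (l i <= l n)%N.
  elim: n {IH lk Nkl kl1 gapn ytr yl yldl} kl gap => [|n IHn] kl gap.
    by rewrite leqn0 => /eqP->.
  rewrite leq_eqVlt => /predU1P[->//|]; rewrite ltnS => iN.
  have ln : (l n <= l n.+1)%N.
    rewrite (leq_trans (leq_addr N _))// (leq_trans (gap n _))//.
    exact: (kl n.+1).
  apply: leq_trans ln; apply: IHn => // j jn; first by rewrite kl// ltnW.
  by rewrite gap// ltnW.
have [z [Pz zx zK zL [zdl zdl']]] := block_replacement (Px n.+1) dl01 kl1.
have z1 i : 0 <= z i <= 1 by have [] := Pz i.
have yl1 : dl / 2 <= y (l n) <= 1.
  by rewrite yldl; have [/andP[]] := Py (l n).
have zk1 : dl / 2 <= z (k n.+1) <= 1.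
  by have := z1 (k n.+1); lra.
have [c [c1 [q [Pq q0 qN]]]] := hN _ _ yl1 zk1.
(* Scaling preserves the multipliers, so the whole of [z] can be lowered to start where the
   connection arrives. *)
pose w i := c * z (k n.+1 + i)%N.
have Pw : is_path w.
  by apply: scale_path; [lra|exact: drop_path].
pose u := glue y (l n) q.
have Pu : is_path u by exact: glue_path.
have uw : w 0%N = u (k n.+1) by rewrite /u glueEr// qN ?/w ?addn0.
have wE j : (k n.+1 <= j)%N -> glue u (k n.+1) w j = c * z j.
  by move=> kj; rewrite glueEr// /w subnKC.
exists (glue u (k n.+1) w); split.
- exact: glue_path.
- move=> i j; rewrite ltnS leq_eqVlt => /predU1P[->|iN] jkl; last first.
    have jl : (j <= l n)%N.
      by have /andP[_ /leq_trans] := jkl; apply; exact: lmono.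
    by rewrite glueEl ?(leq_trans jl)// /u glueEl//; apply: ytr.
  have /andP[kj jl] := jkl; rewrite wE//.
  have := zx j jkl; have := z1 j; rewrite !ler_norml => /andP[zj0 zj1].
  by move=> /andP[h1 h2]; apply/andP; split; nra.
- by move=> j lj; rewrite !wE// ?(leq_trans kl1)// zL.
- by rewrite wE//; nra.
Qed.

(** After time [n] the multipliers are free. A slight scaling makes the value at time [n] exactly
    the inverse of some 3^a/2^b, from which [reach_pow] climbs to 1. *)
Lemma path_hits_one x n eps : is_path x -> 0 < eps ->
  exists y i, [/\ is_path y, y i = 1 & forall j, (j <= n)%N -> `|y j - x j| <= eps].
Proof.
move=> Px eps0; pose dl := Num.min (eps / 4) 2^-1.
have dl0 : 0 < dl by rewrite lt_min; apply/andP; split; lra.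
have dle : 4 * dl <= eps.
  have : dl <= eps / 4 by rewrite ge_min lexx.
  by lra.
have dl2 : dl <= 2^-1 by rewrite ge_min lexx orbT.
have dl01 : 0 < dl <= 1 by lra.
have [z [Pz zx _ _ [_ zdl]]] := block_replacement Px dl01 (leq0n n).
have z1 i : 0 <= z i <= 1 by have [] := Pz i.
have [zn0 zn1] := andP (z1 n).
have zn : 0 < z n by apply: lt_le_trans zdl.
have hdl0 : 0 < dl / 2 by lra.
have [N hN] := pow_ratio_dense dl0 hdl0.
have d0 : 0 < (1 - dl) * z n by rewrite mulr_gt0//; lra.
(* With this target, [q] lies between 1 / z n and 1 / ((1 - dl) * z n), so the scaling factor 1 / (q
   * z n) is between 1 - dl and 1. *)
have [|a [b [_]]] := hN ((1 - dl) * z n)^-1.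
  rewrite lef_pV2 ?posrE//; apply/andP; split; last by nra.
  by apply: (@le_trans _ _ 1); [lra|rewrite invf_ge1//; nra].
set q := 3 ^+ a / 2 ^+ b.
move=> /andP[].
rewrite ler_pdivrMr// -[((1 - dl) * z n)^-1]mul1r ler_pdivlMr// => qlo qhi.
have q0 : 0 < q by rewrite divr_gt0// exprn_gt0.
pose c := (q * z n)^-1.
have c1 : 1 - dl <= c <= 1.
  have qz : 0 < q * z n by rewrite mulr_gt0.
  rewrite -[c]mul1r ler_pdivlMr// ler_pdivrMr// mul1r.
  have : 1 <= q * z n by rewrite -(ler_pM2l (_ : 0 < 1 - dl)); lra.
  by lra.
pose w i := c * z i.
have Pw : is_path w by apply: scale_path => //; lra.
have wq : w n * q = 1 by rewrite /w /c; field; rewrite !gt_eqF.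
have wn : 0 < w n <= 1.
  by have [/andP[_ ->]] := Pw n; rewrite mulr_gt0// invr_gt0 mulr_gt0.
have [|p [Pp p0 p1]] := @reach_pow a b (w n) wn; first by rewrite -/q wq.
rewrite -/q wq in p1.
exists (glue w n p), (n + (a + b))%N; split.
- exact: glue_path.
- by rewrite glueEr// ?leq_addr// addKn p1.
- move=> j jn; rewrite glueEl//; have := zx j jn; have := z1 j.
  rewrite !ler_norml /w => /andP[zj0 zj1] /andP[h1 h2].
  by apply/andP; split; nra.
Qed.

End paths.

(** * Arcs in metric spaces *)

Section arcs.
Variables (R : realType) (X : metricType R).
Implicit Types (S A : set X) (a b x : X) (f : R -> X).

(** The common trace of [U] and [C] is open and closed in [S], hence it is all of [S]. *)
Lemma connected_split S U C : connected S -> open U -> closed C ->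
  S `&` U = S `&` C -> S `&` U !=set0 -> S `<=` U.
Proof.
move=> cS oU cC e ne; apply/setIidPl.
by apply: cS => //; [exists U|exists C].
Qed.

Lemma lipschitz_within f (D : set R) k :
  (forall s t, D s -> D t -> mdist (f s) (f t) <= k * `|s - t|) ->
  {within D, continuous f}.
Proof.
move=> fk; apply/subspace_continuousP => s Ds.
apply/metricType_numDomainType.cvgrPdist_lt => eps eps0.
have k0 : 0 < `|k| + 1 by rewrite ltr_wpDl.
rewrite near_withinE; apply/nbhs_ballP.
exists (eps / (`|k| + 1)) => /=; first by rewrite divr_gt0.
move=> t; rewrite /ball/= => st Dt; apply: (le_lt_trans (fk _ _ Ds Dt)).
apply: (@le_lt_trans _ _ ((`|k| + 1) * `|s - t|)); last by rewrite mulrC -ltr_pdivlMr.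
by rewrite ler_wpM2r// (le_trans (ler_norm k))// lerDl.
Qed.

(** Closed subsets of [0, 1] are compact, so their images are closed; this is the continuity of the
    inverse. *)
Lemma is_arc_of_inj f : {within `[0, 1], continuous f} ->
  {in `[0, 1] &, injective f} -> is_arc (f @` `[0, 1]) (f 0) (f 1).
Proof.
move=> cf inj.
pose g x : R := xget 0 [set t | `[0, 1]%classic t /\ f t = x].
have gK : {in `[0, 1], cancel f g}.
  move=> t t01; have [] : [set u | `[0, 1]%classic u /\ f u = f t] (g (f t)).
    by apply: xgetPex; exists t.
  by move=> g01 /inj; apply.
exists f, g; split=> //; split=> //.
apply/continuous_closedP => C cC; apply/closed_subspaceP.
exists (f @` (`[0, 1] `&` C)).
  apply: compact_closed; first exact: metric_hausdorff.
  apply: continuous_compact.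
    by apply: continuous_subspaceW cf => t [].
  apply: (subclosed_compact _ (@segment_compact R 0 1)); last by move=> t [].
  by apply: closedI => //; exact: interval_closed.
apply/seteqP; split=> x /=.
  move=> [[t [t01 Ct] <-] _]; split; last by exists t.
  by rewrite /from_subspace gK.
move=> [+ [t t01 tx]]; rewrite /from_subspace -tx gK// => Ct.
by split; exists t.
Qed.

Lemma segment_image f s t : {within `[0, 1], continuous f} -> 0 <= s -> t <= 1 ->
  compact (f @` `[s, t]) /\ connected (f @` `[s, t]).
Proof.
move=> cf s0 t1; have {}cf : {within `[s, t], continuous f}.
  by apply: continuous_subspaceW cf => u /=; rewrite !in_itv/= => /andP[? ?]; lra.
split; first exact: (continuous_compact cf (@segment_compact R s t)).
exact: connected_continuous_connected (@segment_connected R s t) cf.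
Qed.

(** The pieces are the images of [0, t] and [t, 1]. Statements about arcs thereby reduce to
    statements about two continua with one common point. *)
Lemma arc_cut A a b x : is_arc A a b -> A x -> exists S1 S2 : set X,
  [/\ compact S1 /\ connected S1, compact S2 /\ connected S2,
      S1 a /\ S2 b, S1 `|` S2 = A & S1 `&` S2 = [set x]].
Proof.
move=> [f [g [[cf _ <- gK] [<- <-]]]] [t /=]; rewrite in_itv/= => /andP[t0 t1] <-.
exists (f @` `[0, t]), (f @` `[t, 1]); split.
- exact: segment_image.
- exact: segment_image.
- by split; [exists 0|exists 1] => //; rewrite /= in_itv/= ?lexx ?t0 ?t1.
- rewrite -image_setU; congr (_ @` _).
  apply/seteqP; split => u /=; rewrite !in_itv/=.
    by case=> /andP[? ?]; lra.
  by move=> /andP[u0 u1]; case: (lerP u t) => h; [left|right]; lra.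
- apply/seteqP; split => [y [[u + <-] [v + e]]|y ->].
    rewrite /= !in_itv/= => /andP[u0 ut] /andP[tv v1].
    have uv : v = u.
      by rewrite -[v]gK ?e ?gK// in_itv/=; lra.
    by congr f; lra.
  by split; exists t => //; rewrite /= in_itv/= lexx ?t0 ?t1.
Qed.

Lemma arc_continuum A a b : is_arc A a b ->
  [/\ compact A, connected A, A a, A b & a <> b].
Proof.
move=> [f [g [[cf _ <- gK] [<- <-]]]].
have [cpt con] := segment_image cf (lexx 0) (lexx 1).
have i0 : (0 : R) \in `[0, 1] by rewrite in_itv/= lexx ler01.
have i1 : (1 : R) \in `[0, 1] by rewrite in_itv/= lexx ler01.
split=> //.
move=> /(congr1 g); rewrite !gK// => /eqP; rewrite eq_sym oner_eq0//.
Qed.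

End arcs.

(** * Fans of sequences *)

(* [e x i] is the i-th coordinate of [x], all of them being multiples of the
   coordinate at [i0] with finitely many possible ratios; the points with given
   ratios form a leg with top [o], the point with zero coordinates. *)
Section sequence_fan.
Variables (R : realType) (X : metricType R) (T : eqType).
Variables (w : T -> nat) (e : X -> T -> R) (i0 : T) (o : X).
Hypothesis e01 : forall x i, 0 <= e x i <= 1.
Hypothesis mdist_sup : forall x y, mdist x y = sup_dist w (e x) (e y).
Hypothesis w_fin : forall n, exists s : seq T, forall i, (w i <= n)%N -> i \in s.
Hypothesis oE : forall i, e o i = 0.
Hypothesis e_ratio : forall i, exists B : seq R,
  forall x, exists b, [/\ b \in B, 0 < b & e x i = b * e x i0].
Hypothesis e_scale : forall x c, 0 <= c -> (forall i, c * e x i <= 1) ->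
  exists y, forall i, e y i = c * e x i.
Implicit Types (x y z u : X) (S A : set X) (c r s t : R) (i : T).

(** * Coordinates and the metric *)

Lemma coord_dist_le x y i : `|e x i - e y i| <= 2 ^+ w i * mdist x y.
Proof.
rewrite mdist_sup mulrC -ler_pdivrMr ?exprn_gt0//.
exact: (sup_dist_ub w i (e01 x) (e01 y)).
Qed.

Lemma mdist_le x y c : (forall i, `|e x i - e y i| <= c) -> mdist x y <= c.
Proof.
move=> h; rewrite mdist_sup; apply: (sup_dist_le i0) => i.
apply: le_trans (h i); rewrite ler_pdivrMr ?exprn_gt0// ler_peMr//.
by rewrite exprn_ege1// ler1n.
Qed.

(** Coordinates of weight above [N] differ by at most 1, so they contribute at most 2^-N <= eps /
    2. *)
Lemma mdist_lt eps : 0 < eps -> exists N, forall x y,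
  (forall i, (w i <= N)%N -> `|e x i - e y i| <= eps / 2) -> mdist x y < eps.
Proof.
move=> eps0; have [N hN] := @expr_unbounded R 2 (2 / eps) ltac:(by rewrite ltr1n).
exists N => x y exy; apply: (@le_lt_trans _ _ (eps / 2)); last by lra.
rewrite mdist_sup; apply: (sup_dist_le i0) => i.
rewrite ler_pdivrMr ?exprn_gt0//; have [wi|wi] := leqP (w i) N.
  apply: le_trans (exy i wi) _; rewrite ler_peMr ?exprn_ege1 ?ler1n//.
  by rewrite divr_ge0// ltW.
apply: (@le_trans _ _ 1).
  by have := e01 x i; have := e01 y i; rewrite ler_norml; lra.
have : 2 / eps <= 2 ^+ w i.
  by apply: (le_trans hN); rewrite ler_weXn2l// ?ler1n// ltnW.
by rewrite ler_pdivrMr// => h; lra.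
Qed.

Lemma coord_inj x y : (forall i, e x i = e y i) -> x = y.
Proof.
move=> exy; apply: mdist_positivity; apply/eqP; rewrite eq_le mdist_ge0 andbT.
by apply: mdist_le => i; rewrite exy subrr normr0.
Qed.

Lemma coord_continuous i : continuous (e^~ i).
Proof.
move=> x; apply/cvgrPdist_lt => eps eps0.
apply/nbhs_ballP; exists (eps / 2 ^+ w i) => /=.
  by rewrite divr_gt0// exprn_gt0.
move=> y; rewrite ballEmdist/= ltr_pdivlMr ?exprn_gt0// mulrC.
exact: le_lt_trans (coord_dist_le x y i).
Qed.

Lemma closed_ratio i c : closed [set x | e x i = c * e x i0].
Proof.
rewrite [X in closed X](_ : _ = (fun x => e x i - c * e x i0) @^-1` [set 0]).
  apply: preimage_closed; last exact: closed_eq.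
  move=> x _; apply: cvgB; first exact: coord_continuous.
  by apply: cvgM; [exact: cvg_cst|exact: coord_continuous].
by apply/seteqP; split=> x /=; [move->; rewrite subrr|move/subr0_eq].
Qed.

Lemma open_coord_gt i c : open [set x | c < e x i].
Proof.
apply: (@open_comp _ _ (e^~ i) [set r | c < r]); last exact: open_gt.
by move=> x _; exact: coord_continuous.
Qed.

Lemma closed_coord_ge i c : closed [set x | c <= e x i].
Proof.
apply: (@preimage_closed _ _ (e^~ i) [set r | c <= r]); last exact: closed_ge.
by move=> x _; exact: coord_continuous.
Qed.

(** * Separation of the legs, and continua within a leg *)

Lemma coord0_eq x : e x i0 = 0 -> x = o.
Proof.
move=> x0; apply: coord_inj => i; have [B /(_ x)[b [_ _ ->]]] := e_ratio i.
by rewrite x0 mulr0 oE.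
Qed.

Lemma coord_gt0 x i : x <> o -> 0 < e x i.
Proof.
move=> xo; have [B /(_ x)[b [_ b0 ->]]] := e_ratio i.
rewrite mulr_gt0// lt_neqAle; have /andP[-> _] := e01 x i0.
by rewrite andbT eq_sym; apply/eqP => /coord0_eq.
Qed.

(* Open because there are only finitely many ratios. *)
Lemma open_ratio u i : u <> o ->
  open [set x | 0 < e x i0 /\ e x i = e u i / e u i0 * e x i0].
Proof.
move=> uo; set b := e u i / e u i0.
have [B eB] := e_ratio i.
suff openB (s : seq R) : open [set x | forall c, c \in s -> c != b ->
    e x i <> c * e x i0].
  rewrite [X in open X](_ : _ = [set x | 0 < e x i0] `&`
      [set x | forall c, c \in B -> c != b -> e x i <> c * e x i0]).
    by apply: openI => //; exact: open_coord_gt.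
  apply/seteqP; split=> x /= [x0 h]; split=> //.
    move=> c _ cb xc; move: cb; rewrite xc in h.
    by rewrite (mulIf _ h) ?eqxx// gt_eqF.
  have [c [cB _ xc]] := eB x; case: (eqVneq c b) => [<-//|cb].
  by have := h c cB cb.
elim: s => [|c s IH].
  by rewrite [X in open X](_ : _ = setT); [exact: openT|apply/seteqP; split].
rewrite [X in open X](_ : _ = [set x | c != b -> e x i <> c * e x i0] `&`
    [set x | forall c, c \in s -> c != b -> e x i <> c * e x i0]); last first.
  apply/seteqP; split=> x /=.
    by move=> h; split=> [|d ds]; apply: h; rewrite in_cons ?eqxx ?ds ?orbT.
  by move=> [h1 h2] d; rewrite in_cons => /predU1P[->|]; [exact: h1|exact: h2].
apply: openI => //; case: (eqVneq c b) => _.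
  by rewrite [X in open X](_ : _ = setT); [exact: openT|apply/seteqP; split].
rewrite [X in open X](_ : _ = ~` [set x | e x i = c * e x i0]); last first.
  by apply/seteqP; split=> x /=; [exact|].
by apply: closed_openC; exact: closed_ratio.
Qed.

(** Away from the top, having the same ratio as [x] at a given coordinate is both an open and a
    closed condition, so it passes from [x] to all of [S]. *)
Lemma connected_leg S x y : connected S -> ~ S o -> S x -> S y ->
  exists2 r, 0 < r & forall i, e y i = r * e x i.
Proof.
move=> cS So Sx Sy; have nz z : S z -> z <> o by move=> Sz zo; rewrite zo in Sz.
have x0 i : 0 < e x i by apply: coord_gt0; exact: nz.
exists (e y i0 / e x i0); first by rewrite divr_gt0// coord_gt0//; exact: nz.
move=> i.
have [||_ ->] := connected_split cS (open_ratio i (nz x Sx))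
    (@closed_ratio i (e x i / e x i0)) _ _ Sy.
- apply/seteqP; split=> z [Sz /=]; first by case.
  by move=> ez; split=> //; split=> //; apply: coord_gt0; exact: nz.
- by exists x; split=> //=; rewrite x0 divfK// gt_eqF.
- by rewrite mulrAC [e x i * _]mulrC mulrAC.
Qed.

(* If [z] is not in [S], neither are the points near it; so in [S] no point has
   the same coordinate as [z] at [i0] and the same ratios as [u] in a large finite
   set of coordinates, and the points of [S] with these ratios lying beyond [z]
   are open and closed in [S]. *)
Lemma continuum_segment S u s r t x y z : compact S -> connected S ->
  0 <= s -> s <= r <= t ->
  (forall i, e x i = s * e u i) -> (forall i, e y i = t * e u i) ->
  (forall i, e z i = r * e u i) -> S x -> S y -> S z.
Proof.
move=> kS cS s0 /andP[sr rt] xE yE zE Sx Sy.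
have xz : s = r -> S z.
  by move=> srE; rewrite (_ : z = x)//; apply: coord_inj => i; rewrite zE xE srE.
have [uo|/eqP uo] := eqVneq u o.
  rewrite (_ : z = x)//; apply: coord_inj => i.
  by rewrite zE xE uo oE !mulr0.
have u0 i : 0 < e u i by exact: coord_gt0.
move: sr; rewrite le_eqVlt => /predU1P[/xz//|{xz} sr].
have r0 : 0 < r by apply: le_lt_trans sr.
have {rt}[tr|rt] : t = r \/ r < t.
  by move: rt; rewrite le_eqVlt => /predU1P[->|]; [left|right].
  by rewrite (_ : z = y)//; apply: coord_inj => i; rewrite zE yE tr.
apply: contrapT => Sz.
have /nbhs_ballP[eps /= eps0 Beps] : nbhs z (~` S).
  have : open (~` S).
    by apply: closed_openC; apply: compact_closed kS; exact: metric_hausdorff.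
  by move=> oS; exact: open_nbhs_nbhs.
have [N hN] := mdist_lt eps0.
have [F hF] := w_fin N.
pose U (G : seq T) := [set v | e z i0 < e v i0 /\
  forall i, i \in G -> 0 < e v i0 /\ e v i = e u i / e u i0 * e v i0].
pose C (G : seq T) := [set v | e z i0 <= e v i0 /\
  forall i, i \in G -> e v i = e u i / e u i0 * e v i0].
have z0 : 0 < e z i0 by rewrite zE mulr_gt0.
have oU G : open (U G).
  elim: G => [|i G IH].
    rewrite (_ : U [::] = [set v | e z i0 < e v i0]); first exact: open_coord_gt.
    by apply/seteqP; split=> v; [case|].
  rewrite (_ : U (i :: G) = U G `&`
      [set v | 0 < e v i0 /\ e v i = e u i / e u i0 * e v i0]).
    by apply: openI => //; exact: open_ratio.
  apply/seteqP; split=> v.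
    move=> [zv h]; split; last by apply: h; rewrite mem_head.
    by split=> // j jG; apply: h; rewrite in_cons jG orbT.
  by move=> [[zv h] vi]; split=> // j; rewrite in_cons => /predU1P[->|/h].
have cC G : closed (C G).
  elim: G => [|i G IH].
    rewrite (_ : C [::] = [set v | e z i0 <= e v i0]); first exact: closed_coord_ge.
    by apply/seteqP; split=> v; [case|].
  rewrite (_ : C (i :: G) = C G `&` [set v | e v i = e u i / e u i0 * e v i0]).
    by apply: closedI => //; exact: closed_ratio.
  apply/seteqP; split=> v.
    move=> [zv h]; split; last by apply: h; rewrite mem_head.
    by split=> // j jG; apply: h; rewrite in_cons jG orbT.
  by move=> [[zv h] vi]; split=> // j; rewrite in_cons => /predU1P[->|/h].
have UC : S `&` U F = S `&` C F.
  apply/seteqP; split=> v [Sv [zv h]]; split=> //; split.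
  - exact: ltW.
  - by move=> i /h[].
  - rewrite lt_neqAle zv andbT; apply/eqP => zv0.
    apply: (Beps v) => //; rewrite ballEmdist /=; apply: hN => i wi.
    rewrite h ?hF// -zv0 !zE mulrCA divfK ?gt_eqF//.
    by rewrite subrr normr0 divr_ge0// ltW.
  - by move=> i iF; split; [exact: lt_le_trans zv|exact: h].
(* [y] belongs to [U F], so all of [S] does; but [x] lies below [z]. *)
have [|xz _] := connected_split cS (oU F) (cC F) UC _ Sx.
  exists y; split=> //; split; first by rewrite zE yE ltr_pM2r.
  by move=> i _; rewrite !yE mulr_gt0// 1?(lt_trans r0)// mulrCA divfK// gt_eqF.
by move: xz; rewrite zE xE ltr_pM2r// ltNge ltW.
Qed.

(** * Parametrized legs and arcwise connectedness *)

Definition scale u r : X := xget o [set y | forall i, e y i = r * e u i].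

(** A multiple by r <= 1 keeps the coordinates at most 1, so it exists by [e_scale] and [xget] does
    not fall back on [o]. *)
Lemma scaleE u r i : 0 <= r <= 1 -> e (scale u r) i = r * e u i.
Proof.
move=> /andP[r0 r1]; apply: (xgetPex o (P := [set y | forall i, e y i = r * e u i])).
apply: e_scale => // j; have /andP[? ?] := e01 u j.
by rewrite mulr_ile1.
Qed.

Let in01_0 : 0 <= (0 : R) <= 1. Proof. by rewrite lexx ler01. Qed.

Let in01_1 : 0 <= (1 : R) <= 1. Proof. by rewrite ler01 lexx. Qed.

Lemma scale0 u : scale u 0 = o.
Proof. by apply: coord_inj => i; rewrite scaleE// mul0r oE. Qed.

Lemma scale1 u : scale u 1 = u.
Proof. by apply: coord_inj => i; rewrite scaleE// mul1r. Qed.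

Lemma scale_dist u s t : 0 <= s <= 1 -> 0 <= t <= 1 ->
  mdist (scale u s) (scale u t) <= `|s - t|.
Proof.
move=> s01 t01; apply: mdist_le => i; rewrite !scaleE// -mulrBl normrM.
by have /andP[u0 u1] := e01 u i; rewrite ler_piMr// ger0_norm.
Qed.

Lemma scale_inj u s t : u <> o -> 0 <= s <= 1 -> 0 <= t <= 1 ->
  scale u s = scale u t -> s = t.
Proof.
move=> uo s01 t01 /(congr1 (e^~ i0)); rewrite !scaleE//; apply: mulIf.
by rewrite gt_eqF// coord_gt0.
Qed.

Lemma scale_arc u s t : u <> o -> 0 <= s <= 1 -> 0 <= t <= 1 -> s <> t ->
  is_arc ((fun r => scale u (s + r * (t - s))) @` `[0, 1]) (scale u s) (scale u t).
Proof.
move=> uo /andP[s0 s1] /andP[t0 t1] st.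
have P01 r : 0 <= r <= 1 -> 0 <= s + r * (t - s) <= 1.
  by move=> /andP[r0 r1]; apply/andP; split; nra.
pose f r := scale u (s + r * (t - s)).
have -> : scale u s = f 0 by rewrite /f mul0r addr0.
have -> : scale u t = f 1 by rewrite /f mul1r addrC subrK.
apply: is_arc_of_inj.
  apply: (@lipschitz_within _ _ _ _ 1) => r r'; rewrite /= !in_itv/= => r01 r'01.
  rewrite mul1r; apply: le_trans (scale_dist _ (P01 _ r01) (P01 _ r'01)) _.
  have -> : s + r * (t - s) - (s + r' * (t - s)) = (r - r') * (t - s) by ring.
  by rewrite normrM ler_piMr// ler_norml; lra.
move=> r r'; rewrite /= !in_itv/= => r01 r'01 /scale_inj.
move=> /(_ uo (P01 _ r01) (P01 _ r'01))/addrI/mulIf; apply.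
by apply/eqP => /subr0_eq/esym.
Qed.

Lemma leg_arc u : u <> o -> is_arc (scale u @` `[0, 1]) o u.
Proof.
move=> uo; have /eqP/nesym := oner_neq0 R => /(scale_arc uo in01_0 in01_1).
rewrite scale0 scale1.
congr (is_arc _ o u); congr (_ @` _).
by apply/funext => r; rewrite add0r subr0 mulr1.
Qed.

(** The arc descends from [a] to the top in the first half of the time and ascends to [b] in the
    second. A coincidence between the halves would make [b] a positive multiple of [a]. *)
Lemma two_leg_arc a b : a <> o -> b <> o ->
  (forall r, 0 < r -> ~ forall i, e b i = r * e a i) -> exists A, is_arc A a b.
Proof.
move=> ao bo nab.
pose f r := if r <= 2^-1 then scale a (1 - 2 * r) else scale b (2 * r - 1).
have fL r : r <= 2^-1 -> f r = scale a (1 - 2 * r) by rewrite /f => ->.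
have fR r : 2^-1 < r -> f r = scale b (2 * r - 1) by rewrite /f ltNge; case: ifP.
have f0 : f 0 = a by rewrite /f invr_ge0 ler0n mulr0 subr0 scale1.
have f1 : f 1 = b.
  rewrite /f ifF ?mulr1; last by apply/negbTE; rewrite -ltNge; lra.
  by rewrite -[X in _ - X]/(1%:R) -natrB// scale1.
exists (f @` `[0, 1]); rewrite -[X in is_arc _ X _]f0 -[X in is_arc _ _ X]f1.
have lP r : 0 <= r <= 1 -> r <= 2^-1 -> 0 <= 1 - 2 * r <= 1 by lra.
have rP r : 0 <= r <= 1 -> 2^-1 < r -> 0 <= 2 * r - 1 <= 1 by lra.
apply: is_arc_of_inj.
  have mid r r' : 0 <= r <= 1 -> 0 <= r' <= 1 -> r <= 2^-1 -> 2^-1 < r' ->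
      mdist (f r) (f r') <= 2 * (r' - r).
    move=> r01 r'01 rh r'h; rewrite fL// fR//.
    apply: le_trans (metric_triangle _ o _) _.
    rewrite -[X in mdist _ X + _](scale0 a) -[X in _ + mdist X _](scale0 b).
    apply: le_trans (lerD (scale_dist _ (lP _ r01 rh) in01_0)
      (scale_dist _ in01_0 (rP _ r'01 r'h))) _.
    rewrite subr0 sub0r normrN !ger0_norm; lra.
  apply: (@lipschitz_within _ _ _ _ 2) => r r'; rewrite /= !in_itv/= => r01 r'01.
  have [rh|rh] := lerP r 2^-1; have [r'h|r'h] := lerP r' 2^-1.
  - rewrite !fL//; apply: le_trans (scale_dist _ (lP _ r01 rh) (lP _ r'01 r'h)) _.
    have -> : 1 - 2 * r - (1 - 2 * r') = 2 * - (r - r') by ring.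
    by rewrite normrM normrN ger0_norm.
  - by apply: le_trans (mid _ _ r01 r'01 rh r'h) _; rewrite ler_wpM2l// distrC ler_norm.
  - rewrite metric_sym; apply: le_trans (mid _ _ r'01 r01 r'h rh) _.
    by rewrite ler_wpM2l// ler_norm.
  - rewrite !fR//.
    apply: le_trans (scale_dist _ (rP _ r01 rh) (rP _ r'01 r'h)) _.
    have -> : 2 * r - 1 - (2 * r' - 1) = 2 * (r - r') by ring.
    by rewrite normrM ger0_norm.
have sep r r' : 0 <= r <= 1 -> 0 <= r' <= 1 -> r <= 2^-1 -> 2^-1 < r' -> f r <> f r'.
  move=> r01 r'01 rh r'h; rewrite fL// fR// => E.
  have c0 : 0 < 2 * r' - 1 by lra.
  have E' i : (1 - 2 * r) * e a i = (2 * r' - 1) * e b i.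
    by rewrite -(scaleE a i (lP _ r01 rh)) -(scaleE b i (rP _ r'01 r'h)) E.
  have d0 : 0 < 1 - 2 * r.
    rewrite -(@pmulr_lgt0 _ (e a i0)) ?coord_gt0// E' mulr_gt0// coord_gt0//.
  apply: (nab ((1 - 2 * r) / (2 * r' - 1))); first by rewrite divr_gt0.
  by move=> i; rewrite mulrAC E' mulrAC divff ?mul1r// gt_eqF.
move=> r r'; rewrite /= !in_itv/= => r01 r'01.
have [rh|rh] := lerP r 2^-1; have [r'h|r'h] := lerP r' 2^-1.
- rewrite !fL// => /(scale_inj ao (lP _ r01 rh) (lP _ r'01 r'h)); lra.
- by move=> /(sep _ _ r01 r'01 rh r'h).
- by move/esym => /(sep _ _ r'01 r01 r'h rh).
- rewrite !fR// => /(scale_inj bo (rP _ r01 rh) (rP _ r'01 r'h)); lra.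
Qed.

Lemma fan_arcwise_connected : arcwise_connected X.
Proof.
move=> a b ab.
have [ao|/eqP ao] := eqVneq a o.
  by exists (scale b @` `[0, 1]); rewrite ao; apply: leg_arc => bo; rewrite ao bo in ab.
have [bo|/eqP bo] := eqVneq b o.
  have /eqP := oner_neq0 R => /(scale_arc ao in01_1 in01_0).
  by rewrite scale1 scale0 -bo; eexists; eassumption.
have [[r r0 br]|nab] := pselect (exists2 r, 0 < r & forall i, e b i = r * e a i); last first.
  by apply: two_leg_arc => // r r0 br; apply: nab; exists r.
have r1 : r <> 1.
  by move=> r1; apply: ab; apply: coord_inj => i; rewrite br r1 mul1r.
(* Both points are on one leg; the one farther from the top serves to parametrize it. *)
have [rlt1|rge1] := ltrP r 1.
  have r01 : 0 <= r <= 1 by lra.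
  have -> : b = scale a r by apply: coord_inj => i; rewrite scaleE.
  by rewrite -{1}(scale1 a); eexists; apply: scale_arc => // /esym.
have r01 : 0 <= r^-1 <= 1 by rewrite invr_ge0 ltW// invf_le1.
have -> : a = scale b r^-1.
  by apply: coord_inj => i; rewrite scaleE// br mulKf// gt_eqF.
rewrite -{2}(scale1 b); eexists; apply: scale_arc => // /(congr1 (@GRing.inv R)).
by rewrite invrK invr1.
Qed.

Lemma scale_continuous u : {within `[0, 1], continuous (scale u)}.
Proof.
apply: (@lipschitz_within _ _ _ _ 1) => s t; rewrite /= !in_itv/= => s01 t01.
by rewrite mul1r; exact: scale_dist.
Qed.

Lemma leg_connected u : connected (scale u @` `[0, 1]).
Proof. by have [] := segment_image (@scale_continuous u) (lexx 0) (lexx 1). Qed.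

Lemma leg_top u : (scale u @` `[0, 1]) o.
Proof. by exists 0; [rewrite /= in_itv|exact: scale0]. Qed.

Lemma leg_end u : (scale u @` `[0, 1]) u.
Proof. by exists 1; [rewrite /= in_itv|exact: scale1]. Qed.

Lemma leg_sub S x : compact S -> connected S -> S o -> S x ->
  scale x @` `[0, 1] `<=` S.
Proof.
move=> kS cS So Sx _ [r + <-]; rewrite /= in_itv/= => r01.
apply: (@continuum_segment S x 0 r 1 o x) => // i.
- by rewrite oE mul0r.
- by rewrite mul1r.
- by rewrite scaleE.
Qed.

(** * Connectedness and hereditary unicoherence *)

Hypothesis X_compact : compact [set: X].

Lemma fan_continuum : continuum [set: X].
Proof.
split=> //; first by exists o.
rewrite (_ : setT = \bigcup_(u in [set: X]) (scale u @` `[0, 1])).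
  apply: bigcup_connected; last by move=> u _; exact: leg_connected.
  by exists o => u _; exact: leg_top.
by apply/seteqP; split => // u _; exists u => //; exact: leg_end.
Qed.

(** The part of the leg between [y] and [x] lies in each of the two continua by [continuum_segment],
    hence in their intersection. *)
Lemma component_ray A B x y r : continuum A -> continuum B ->
  (A `&` B) x -> (A `&` B) y -> 0 <= r <= 1 -> (forall i, e y i = r * e x i) ->
  connected_component (A `&` B) x y.
Proof.
move=> [_ kA cA] [_ kB cB] [Ax Bx] [Ay By] /andP[r0 r1] yr.
have yE : y = scale x r by apply: coord_inj => i; rewrite scaleE ?r0.
exists (scale x @` `[r, 1]); last by exists r; rewrite ?yE//= in_itv/= lexx.
split; first by exists 1; rewrite ?scale1//= in_itv/= r1 lexx.
  move=> _ [q + <-]; rewrite /= in_itv/= => /andP[rq q1].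
  have q01 : 0 <= q <= 1 by rewrite q1 (le_trans r0).
  have seg S : compact S -> connected S -> S x -> S y -> S (scale x q).
    move=> kS cS Sx Sy.
    apply: (@continuum_segment S x r q 1 y x) => //; first by rewrite rq.
      by move=> i; rewrite mul1r.
    by move=> i; rewrite scaleE.
  by split; exact: seg.
by have [] := segment_image (@scale_continuous x) r0 (lexx 1).
Qed.

(** If the intersection contains the top, each of its points is joined to the top inside it.
    Otherwise one of the two continua misses the top, so any two common points are on one leg and
    are joined along it. *)
Lemma fan_hereditarily_unicoherent : hereditarily_unicoherent X.
Proof.
move=> _ _ A B cA cB _; have [[x ABx]|] := pselect (A `&` B !=set0); last first.
  by move=> /set0P/negP/negPn/eqP ->; exact: connected0.
suff -> : A `&` B = connected_component (A `&` B) x by exact: component_connected.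
apply/seteqP; split=> y; last exact: connected_component_sub.
move=> ABy; have [ABo|nABo] := pselect ((A `&` B) o).
  have to_top z : (A `&` B) z -> connected_component (A `&` B) z o.
    move=> ABz; apply: (component_ray cA cB ABz ABo in01_0) => i.
    by rewrite oE mul0r.
  apply: connected_component_trans (to_top x ABx) _.
  exact/connected_component_sym/to_top.
have [r r0 yr] : exists2 r, 0 < r & forall i, e y i = r * e x i.
  have [_ kA cnA] := cA; have [_ kB cnB] := cB.
  have [Ax Bx] := ABx; have [Ay By] := ABy.
  have [Ao|nAo] := pselect (A o); last exact: (connected_leg cnA).
  by apply: (connected_leg cnB) => // Bo; exact: nABo.
have [r1|r1] := lerP r 1.
  by apply: component_ray yr => //; rewrite ltW.
apply/connected_component_sym/(@component_ray _ _ _ _ r^-1) => //.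
  by rewrite invr_ge0 ltW// invf_le1// ltW.
by move=> i; rewrite yr mulKf// gt_eqF.
Qed.

(** * Directions at a point: ramification points and endpoints *)

Lemma continuum_ray S x y : compact S -> connected S -> S x -> S y ->
  x <> o -> y <> x -> exists r, [/\ 0 <= r, r <> 1 &
    exists2 z, S z & forall i, e z i = r * e x i].
Proof.
(* If [S] contains the top, the top is the second point on the ray of [x], with ratio 0; otherwise
   [S] stays in the leg of [x] and [y] itself will do. *)
move=> kS cS Sx Sy xo yx; have [So|nSo] := pselect (S o).
  exists 0; split=> //; first by apply/eqP; rewrite eq_sym oner_eq0.
  by exists o => // i; rewrite oE mul0r.
have [r r0 yr] := connected_leg cS nSo Sx Sy.
exists r; split; [exact: ltW| |by exists y].
by move=> r1; apply: yx; apply: coord_inj => i; rewrite yr r1 mul1r.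
Qed.

(** If both ratios were on the same side of 1, the point with ratio closer to 1 would be in both
    continua by [continuum_segment], although they meet in [x] only. *)
Lemma ray_direction S1 S2 x z1 z2 r1 r2 :
  compact S1 -> connected S1 -> compact S2 -> connected S2 ->
  S1 `&` S2 = [set x] -> x <> o -> 0 <= r1 -> r1 <> 1 -> 0 <= r2 -> r2 <> 1 ->
  S1 z1 -> (forall i, e z1 i = r1 * e x i) ->
  S2 z2 -> (forall i, e z2 i = r2 * e x i) -> (r1 < 1) != (r2 < 1).
Proof.
move=> k1 c1 k2 c2 S12 xo.
wlog r12 : S1 S2 z1 z2 r1 r2 k1 c1 k2 c2 S12 / r1 <= r2.
  move=> H; have [r12|/ltW r21] := lerP r1 r2; first exact: (H S1 S2).
  move=> *; rewrite eq_sym; apply: (H S2 S1 z2 z1) => //.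
  by rewrite setIC.
move=> r10 r11 r20 r21 S1z z1E S2z z2E.
have [S1x S2x] : (S1 `&` S2) x by rewrite S12.
have xE i : e x i = 1 * e x i by rewrite mul1r.
have x1 r z : e z i0 = r * e x i0 -> z = x -> r = 1.
  move=> zE zx; rewrite zx [LHS]xE in zE.
  by apply/esym; apply: mulIf zE; rewrite gt_eqF// coord_gt0.
apply/eqP; have [r1lt|r1ge] := ltrP r1 1; have [r2lt|r2ge] // := ltrP r2 1 => _.
  have S1z2 : S1 z2.
    apply: (@continuum_segment S1 x r1 r2 1 z1 x z2) => //.
    by rewrite r12 ltW.
  have : (S1 `&` S2) z2 by [].
  by rewrite S12 => /(x1 r2 z2 (z2E i0)).
have S2z1 : S2 z1.
  apply: (@continuum_segment S2 x 1 r1 r2 x z2 z1) => //.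
  by rewrite r12 r1ge.
have : (S1 `&` S2) z1 by [].
by rewrite S12 => /(x1 r1 z1 (z1E i0)).
Qed.

(** A leg has only two directions at [x], towards the top and away from it, while three arcs meeting
    pairwise only in [x] would need three. *)
Lemma not_ramification x : x <> o -> ~ ramification_point x.
Proof.
move=> xo [A [B [C [a [b [c [[aA aB aC] [AB BC AC]]]]]]]].
have arc_ray S y : is_arc S x y -> [/\ compact S, connected S &
    exists r, [/\ 0 <= r, r <> 1 & exists2 z, S z & forall i, e z i = r * e x i]].
  move=> /arc_continuum[kS cS Sx Sy xy]; split=> //.
  by apply: continuum_ray Sy _ _ => // /esym.
have [kA cA [rA [rA0 rA1 [zA Az zAE]]]] := arc_ray _ _ aA.
have [kB cB [rB [rB0 rB1 [zB Bz zBE]]]] := arc_ray _ _ aB.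
have [kC cC [rC [rC0 rC1 [zC Cz zCE]]]] := arc_ray _ _ aC.
have := ray_direction kA cA kB cB AB xo rA0 rA1 rB0 rB1 Az zAE Bz zBE.
have := ray_direction kB cB kC cC BC xo rB0 rB1 rC0 rC1 Bz zBE Cz zCE.
have := ray_direction kA cA kC cC AC xo rA0 rA1 rC0 rC1 Az zAE Cz zCE.
by case: (rA < 1); case: (rB < 1); case: (rC < 1).
Qed.

(** No multiple of [x] by a factor above 1 is a point, so both pieces of an arc cut at an interior
    point [x] would leave [x] towards the top. *)
Lemma hits_one_endpoint x i : e x i = 1 -> is_endpoint x.
Proof.
move=> xi A a b arcA Ax.
have xo : x <> o by move=> xo; move: xi; rewrite xo oE => /eqP; rewrite eq_sym oner_eq0.
have [S1 [S2 [[k1 c1] [k2 c2] [S1a S2b] _ S12]]] := arc_cut arcA Ax.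
have [S1x S2x] : (S1 `&` S2) x by rewrite S12.
have [xa|xa] := pselect (a = x); first by left.
have [xb|xb] := pselect (b = x); first by right.
have [r1 [r10 r11 [z1 S1z z1E]]] := continuum_ray k1 c1 S1x S1a xo xa.
have [r2 [r20 r21 [z2 S2z z2E]]] := continuum_ray k2 c2 S2x S2b xo xb.
have lt1 r z : r <> 1 -> (forall i, e z i = r * e x i) -> r < 1.
  move=> /eqP rn1 zE; rewrite lt_neqAle rn1 /=.
  by have /andP[_] := e01 z i; rewrite zE xi mulr1.
have := ray_direction k1 c1 k2 c2 S12 xo r10 r11 r20 r21 S1z z1E S2z z2E.
by rewrite (lt1 r1 z1)// (lt1 r2 z2).
Qed.

(** * Arcs from the top, smoothness and the characterization *)

Lemma arc_from_top A x : is_arc A o x -> A = scale x @` `[0, 1].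
Proof.
move=> arcA; have [kA cA Ao Ax _] := arc_continuum arcA.
apply/seteqP; split; last exact: leg_sub.
move=> y Ay; have [->|/eqP yo] := eqVneq y o; first exact: leg_top.
(* The piece from [y] to [x] misses the top, so [y] is on the ray of [x]. If [y] lay beyond [x], the
   piece from the top to [y] would also contain [x], which forces x = y. *)
have [S1 [S2 [[k1 c1] [k2 c2] [S1o S2x] _ S12]]] := arc_cut arcA Ay.
have [S1y S2y] : (S1 `&` S2) y by rewrite S12.
have nS2o : ~ S2 o.
  by move=> S2o; have : (S1 `&` S2) o by []; rewrite S12 => /esym.
have [r r0 yr] := connected_leg c2 nS2o S2x S2y.
have [r1|r1] := lerP r 1.
  exists r; first by rewrite /= in_itv/= ltW.
  by apply: coord_inj => i; rewrite scaleE// ltW.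
have S1x : S1 x.
  apply: (leg_sub k1 c1 S1o S1y); exists r^-1.
    by rewrite /= in_itv/= invr_ge0 ltW// invf_le1// ltW.
  apply: coord_inj => i; rewrite scaleE; first by rewrite yr mulKf// gt_eqF.
  by rewrite invr_ge0 ltW// invf_le1// ltW.
have : (S1 `&` S2) x by [].
by rewrite S12 => ->; exact: leg_end.
Qed.

Lemma arc_or_point_from_top A x : arc_or_point A o x -> A = scale x @` `[0, 1].
Proof.
move=> [|[ox ->]]; first exact: arc_from_top.
rewrite -ox; apply/seteqP; split=> [y ->|_ [r + <-]]; first exact: leg_top.
rewrite /= in_itv/= => r01; apply: coord_inj => i.
by rewrite scaleE// oE mulr0.
Qed.

Lemma scale_mdist x y r : 0 <= r <= 1 -> mdist (scale x r) (scale y r) <= mdist x y.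
Proof.
move=> r01; have /andP[r0 r1] := r01; rewrite [leLHS]mdist_sup.
apply: (sup_dist_le i0) => i; rewrite !scaleE// -mulrBr normrM ger0_norm//.
rewrite -mulrA mdist_sup; apply: le_trans (sup_dist_ub w i (e01 x) (e01 y)).
by rewrite ler_piMl// divr_ge0// exprn_ge0.
Qed.

(** By [scale_mdist], points at the same fraction of two legs are no farther apart than the ends of
    the legs, which bounds the Hausdorff distance of the arcs. *)
Lemma fan_smooth : smooth_at o.
Proof.
move=> x_ x xx A_ A hA_ hA.
have -> : A_ = (fun n => scale (x_ n) @` `[0, 1]).
  by apply/funext => n; exact: arc_or_point_from_top.
rewrite (arc_or_point_from_top hA).
have close y z r S : S = scale z @` `[0, 1] -> mdist y z < r ->
    forall a, (scale y @` `[0, 1]) a -> exists2 b, S b & mdist a b < r.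
  move=> -> yz _ [t + <-]; rewrite /= in_itv/= => t01.
  exists (scale z t); first by exists t => //; rewrite /= in_itv.
  exact: le_lt_trans (scale_mdist _ _ t01) yz.
apply/cvgrPdist_le => eps eps0.
have := metricType_numDomainType.cvgr_dist_lt xx eps0.
move=> /(_ _); apply: filterS => n xn; rewrite sub0r normrN.
rewrite /hausdorff_dist; set E := (X in inf X); have Eeps : E eps.
  split=> //; last exact: close xn.
  by apply: close => //; rewrite metric_sym.
have lbE : lbound E 0 by move=> r [/ltW].
rewrite ger0_norm; first by apply: ge_inf => //; exists 0.
by apply: lb_le_inf => //; exists eps.
Qed.

Definition distinct_legs (a b : X) := forall r, 0 < r -> ~ forall i, e b i = r * e a i.

Lemma leg_disjoint a b : distinct_legs a b ->
  scale a @` `[0, 1] `&` scale b @` `[0, 1] = [set o].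
Proof.
move=> ab; apply/seteqP; split=> [x|x ->]; last by split; exact: leg_top.
move=> [[r + <-] [s +]]; rewrite /= !in_itv/= => /andP[r0 r1] /andP[s0 s1] E.
have E' i : s * e b i = r * e a i.
  by rewrite -(scaleE b i (_ : 0 <= s <= 1)) ?E ?scaleE ?r0 ?s0.
move: r0; rewrite le_eqVlt => /predU1P[<-|r0]; first exact: scale0.
move: s0; rewrite le_eqVlt => /predU1P[s0|s0]; first by rewrite -E -s0 scale0.
have [] := ab (r / s); first by rewrite divr_gt0.
by move=> i; rewrite mulrAC -E' mulrC mulKf// gt_eqF.
Qed.

(** Three points on different legs provide the simple triod that makes the top a ramification
    point. *)
Theorem sequence_fan_Lelek :
  (exists a b c : X, [/\ a <> o, b <> o & c <> o] /\
    [/\ distinct_legs a b, distinct_legs b c & distinct_legs a c]) ->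
  (forall x eps, 0 < eps -> exists y i, mdist x y < eps /\ e y i = 1) ->
  Lelek_fan X.
Proof.
move=> [a [b [c [[ao bo co] [ab bc ac]]]]] dns.
exists o; split; last 2 first.
- exact: fan_smooth.
- move=> O [x Ox] oO.
  have /nbhs_ballP[eps /= eps0 Oeps] : nbhs x O by exact: open_nbhs_nbhs.
  have [y [i [xy yi]]] := dns x eps eps0.
  exists y; split; last exact: hits_one_endpoint yi.
  by apply: Oeps; rewrite ballEmdist.
split.
- exact: fan_continuum.
- exact: fan_arcwise_connected.
- exact: fan_hereditarily_unicoherent.
move=> x; split=> [xr|->].
  by apply: contrapT => xo; exact: not_ramification xr.
exists (scale a @` `[0, 1]), (scale b @` `[0, 1]), (scale c @` `[0, 1]), a, b, c.
by split; split; first [exact: leg_arc|exact: leg_disjoint].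
Qed.

End sequence_fan.

(* Orbits: along [next], coordinates are multiplied by elements of the finite
   set [M] of multipliers, and every such sequence is a point of [X]. *)
Section orbit_space.
Variables (R : realType) (X : metricType R) (T : eqType).
Variables (w : T -> nat) (e : X -> T -> R) (i0 : T) (next : T -> T) (M : seq R).
Hypothesis e01 : forall x i, 0 <= e x i <= 1.
Hypothesis mdist_sup : forall x y, mdist x y = sup_dist w (e x) (e y).
Hypothesis w_fin : forall n, exists s : seq T, forall i, (w i <= n)%N -> i \in s.
Hypothesis w_next : forall i, (w (next i) <= (w i).+1)%N.
Hypothesis next_ind : forall P : T -> Prop, P i0 ->
  (forall i, P i -> P (next i)) -> (forall i, P (next i) -> P i) -> forall i, P i.
Hypothesis M_gt0 : forall a, a \in M -> 0 < a.
Hypothesis M1 : 1 \in M.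
Hypothesis e_next : forall x i, exists2 a, a \in M & e x (next i) = a * e x i.
Hypothesis e_total : forall f : T -> R, (forall i, 0 <= f i <= 1) ->
  (forall i, exists2 a, a \in M & f (next i) = a * f i) ->
  exists x, forall i, e x i = f i.
Implicit Types (x y : X) (i : T).

(** The ratio is a product of multipliers and inverses of multipliers along the way from [i0] to
    [i], so it takes finitely many values. *)
Lemma orbit_ratio i : exists B : seq R,
  forall x, exists b, [/\ b \in B, 0 < b & e x i = b * e x i0].
Proof.
elim/next_ind: i => [|i [B eB]|i [B eB]].
- by exists [:: 1] => x; exists 1; rewrite mem_head ltr01 mul1r.
- exists [seq a * b | a <- M, b <- B] => x.
  have [b [bB b0 xb]] := eB x; have [a aM xa] := e_next x i.
  exists (a * b); split; first by apply/allpairsP; exists (a, b).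
    by rewrite mulr_gt0// M_gt0.
  by rewrite xa xb mulrA.
- exists [seq b / a | a <- M, b <- B] => x.
  have [b [bB b0 xb]] := eB x; have [a aM xa] := e_next x i.
  exists (b / a); split; first by apply/allpairsP; exists (a, b).
    by rewrite divr_gt0// M_gt0.
  by rewrite mulrAC -xb xa mulrC mulKf// gt_eqF// M_gt0.
Qed.

Lemma orbit_scale x c : 0 <= c -> (forall i, c * e x i <= 1) ->
  exists y, forall i, e y i = c * e x i.
Proof.
move=> c0 c1; apply: e_total => i.
  by rewrite c1 mulr_ge0//; have /andP[] := e01 x i.
by have [a aM xa] := e_next x i; exists a => //; rewrite xa mulrCA.
Qed.

(** An ultrafilter converges in each coordinate. If the limit satisfied the relation at some step
    for no multiplier, then each of the finitely many multipliers would fail near the limit, hence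
    all of them at a common point. *)
Lemma orbit_compact : compact [set: X].
Proof.
rewrite compact_ultra => F UF _.
have coord_lim i : exists r : R, 0 <= r <= 1 /\ e x i @[x --> F] --> r.
  have [|r [r01 Fr]] := @segment_compact R 0 1 (e x i @[x --> F]) _.
    by apply: (@filterE _ F) => x; rewrite /= in_itv/= e01.
  exists r; split; first by rewrite /= in_itv in r01.
  move=> V rV; have [//|FV] := in_ultra_setVsetC (e^~ i @^-1` V) UF.
  by have [v [nVv /nVv]] := Fr (~` V) V FV rV.
have {coord_lim}[f fP] := choice coord_lim.
have [|x xf] := e_total (fun i => (fP i).1).
  move=> i; apply: contrapT => nf.
  have {}nf a : a \in M -> f (next i) - a * f i != 0.
    by move=> aM; apply/eqP => /subr0_eq E; apply: nf; exists a.
  have ne a : a \in M -> \forall x \near F, e x (next i) - a * e x i != 0.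
    move=> aM; have : (e x (next i) - a * e x i) @[x --> F] --> f (next i) - a * f i.
      by apply: cvgB; [exact: (fP _).2|apply: cvgM; [exact: cvg_cst|exact: (fP _).2]].
    by move/cvgr_neq0 => /(_ _); apply; exact: nf.
  have {}ne : \forall x \near F, forall a, a \in M -> e x (next i) - a * e x i != 0.
    elim: M ne => [|a m IH] ne.
      by apply: filterS (@filterT _ F _) => x _ a; rewrite in_nil.
    have /IH Fm : forall b, b \in m -> \forall x \near F, e x (next i) - b * e x i != 0.
      by move=> b bm; apply: ne; rewrite in_cons bm orbT.
    apply: filterS2 Fm (ne a (mem_head _ _)) => x xm xa b.
    by rewrite in_cons => /predU1P[->|/xm].
  have [x xM] := filter_ex ne.
  have [a aM xa] := e_next x i.
  by have := xM a aM; rewrite xa subrr eqxx.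
(* Convergence in finitely many coordinates suffices for each [eps], by [mdist_lt]. *)
exists x; split=> //; apply/metricType_numDomainType.fcvgrPdist_lt => eps eps0.
have [N hN] := mdist_lt i0 e01 mdist_sup eps0.
have [s hs] := w_fin N.
have : \forall y \near F, forall i, i \in s -> `|e x i - e y i| <= eps / 2.
  elim: s {hs} => [|i s IH].
    by apply: filterS (@filterT _ F _) => y _ i; rewrite in_nil.
  have e2 : 0 < eps / 2 by rewrite divr_gt0.
  have /cvgrPdist_le/(_ _ e2) := (fP i).2.
  apply: filterS2 IH => y ys yi j; rewrite in_cons => /predU1P[->|/ys//].
  by rewrite xf.
by apply: filterS => y ys; apply: hN => i /hs/ys.
Qed.

(** The map is 2-Lipschitz, since passing to the next coordinate raises the weight by at most 1. *)
Lemma shift_continuous (f : X -> X) :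
  (forall x i, e (f x) i = e x (next i)) -> continuous f.
Proof.
move=> fE x; apply/metricType_numDomainType.cvgrPdist_lt => eps eps0.
apply/nbhs_ballP; exists (eps / 2) => /=; first by rewrite divr_gt0.
move=> y; rewrite ballEmdist/= ltr_pdivlMr//; apply: le_lt_trans.
rewrite [leLHS]mdist_sup; apply: (sup_dist_le i0) => i.
rewrite !fE ler_pdivrMr ?exprn_gt0// -mulrA -exprS.
apply: le_trans (coord_dist_le e01 mdist_sup x y (next i)) _.
rewrite mulrC ler_wpM2l ?mdist_ge0// ler_weXn2l// ?ler1n//.
Qed.

Lemma orbit_space_Lelek : (exists a b c : X,
    [/\ e a i0 != 0, e b i0 != 0 & e c i0 != 0] /\
    [/\ distinct_legs e a b, distinct_legs e b c & distinct_legs e a c]) ->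
  (forall x eps, 0 < eps -> exists y i, mdist x y < eps /\ e y i = 1) ->
  Lelek_fan X.
Proof.
move=> [a [b [c [[a0 b0 c0] abc]]]] dns.
have [||o oE] := @e_total (fun=> 0).
- by move=> _; rewrite lexx ler01.
- by move=> i; exists 1; rewrite ?mulr0.
have no x : e x i0 != 0 -> x <> o by move=> + xo; rewrite xo oE eqxx.
apply: (sequence_fan_Lelek e01 mdist_sup w_fin oE orbit_ratio orbit_scale) => //.
  exact: orbit_compact.
by exists a, b, c; split=> //; split; exact: no.
Qed.

End orbit_space.

(** * One-sided and two-sided orbit spaces *)

Section instances.
Variables (R : realType) (M : seq R).
Let A : set R := [set` M].
Hypotheses (M3 : 3 \in M) (M1 : 1 \in M) (M2 : 2^-1 \in M).
Hypothesis M_bounds : forall a, a \in M -> 3^-1 <= a <= 3.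
Let G := F_ A.

Let M_gt0 a : a \in M -> 0 < a.
Proof. by move/M_bounds; lra. Qed.

Lemma F_P (u v : R) : 0 <= u <= 1 -> 0 <= v <= 1 ->
  (exists2 a, a \in M & v = a * u) -> G (u, v).
Proof. by move=> ? ? [a aM va]; split=> //; split=> //; exists a. Qed.

Lemma fwd_next (x : fwd_space G) i : exists2 a, a \in M & x i.+1 = a * x i.
Proof. by have [_ [_ [a]]] := fwd_G x i; exists a. Qed.

Lemma bi_next (x : bi_space G) i : exists2 a, a \in M & x (i + 1) = a * x i.
Proof. by have [_ [_ [a]]] := bi_G x i; exists a. Qed.

Lemma fwd_total (f : nat -> R) : (forall i, 0 <= f i <= 1) ->
  (forall i, exists2 a, a \in M & f i.+1 = a * f i) ->
  exists x : fwd_space G, forall i, x i = f i.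
Proof.
move=> f01 fM; have fG i : G (f i, f i.+1) by exact: F_P.
by exists (FwdPoint f01 fG).
Qed.

Lemma bi_total (f : int -> R) : (forall i, 0 <= f i <= 1) ->
  (forall i, exists2 a, a \in M & f (i + 1) = a * f i) ->
  exists x : bi_space G, forall i, x i = f i.
Proof.
move=> f01 fM; have fG i : G (f i, f (i + 1)) by exact: F_P.
by exists (BiPoint f01 fG).
Qed.

Lemma path_fwd p : is_path A p -> exists x : fwd_space G, forall i, x i = p i.
Proof. by move=> Pp; apply: fwd_total => i; have [] := Pp i. Qed.

(** The path is placed from position -k on and continued to the left by its first value, with
    multiplier 1. *)
Lemma path_bi p k : is_path A p ->
  exists x : bi_space G, forall n : nat, x (n%:Z - k%:Z) = p n.
Proof.
move=> Pp; pose f (i : int) := if i is Posz n then p n else p 0%N.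
have [|i|x xf] := @bi_total (fun i => f (i + k%:Z)).
- by move=> i; case: (i + k%:Z) => [n|n] /=; have [] := Pp n; have [] := Pp 0%N.
- rewrite addrAC; case: (i + k%:Z) => [n|[|n]].
  + by rewrite -PoszD addn1; have [] := Pp n.
  + by exists 1; rewrite //= mul1r.
  + rewrite (_ : Negz n.+1 + 1 = Negz n); last by rewrite !NegzE; lia.
    by exists 1; rewrite //= mul1r.
by exists x => n; rewrite xf subrK.
Qed.

Lemma fwd_path (x : fwd_space G) : is_path A x.
Proof. by move=> i; split; [exact: fwd_I|exact: fwd_next]. Qed.

Lemma bi_path (x : bi_space G) k : is_path A (fun n => x (n%:Z - k%:Z)).
Proof.
move=> n; split; first exact: bi_I.
have [a aM xa] := bi_next x (n%:Z - k%:Z); exists a => //.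
by rewrite -xa -addn1 PoszD addrAC.
Qed.

Let fwd_w_fin n : exists s : seq nat, forall i, (i.+1 <= n)%N -> i \in s.
Proof. by exists (iota 0 n) => i; rewrite mem_iota add0n. Qed.

Let bi_w_fin n : exists s : seq int, forall i : int, (`|i| <= n)%N -> i \in s.
Proof.
exists ([seq Posz m | m <- iota 0 n.+1] ++ [seq - Posz m | m <- iota 0 n.+1]).
move=> i ni; rewrite mem_cat; apply/orP.
have [i0|i0] := leP 0 i; [left|right]; apply/mapP; exists `|i|%N.
- by rewrite mem_iota.
- by rewrite gez0_abs.
- by rewrite mem_iota.
- by rewrite ltz0_abs// opprK.
Qed.

Let nat_next_ind (P : nat -> Prop) : P 0%N -> (forall i, P i -> P i.+1) ->
  (forall i, P i.+1 -> P i) -> forall i, P i.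
Proof. by move=> P0 PS _; elim. Qed.

Let int_next_ind (P : int -> Prop) : P 0 -> (forall i, P i -> P (i + 1)) ->
  (forall i, P (i + 1) -> P i) -> forall i, P i.
Proof.
move=> P0 PS PP; elim/int_ind => // n IH.
  by rewrite -addn1 PoszD; exact: PS.
by apply: PP; rewrite -addn1 PoszD opprD subrK.
Qed.

Let fwd_mdistE (x y : fwd_space G) : mdist x y = sup_dist (fun i => i.+1) x y.
Proof. by []. Qed.

Let bi_mdistE (x y : bi_space G) : mdist x y = sup_dist (fun i => `|i|%N) x y.
Proof. by []. Qed.

Let A_bounds a : A a -> 3^-1 <= a <= 3. Proof. exact: M_bounds. Qed.

(** The paths are the constant 1, the powers of 1/2, and 1/3 followed by ones; their first
    multipliers 1, 1/2 and 3 differ, so no two are proportional. *)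
Let three_paths : exists p : nat -> nat -> R, [/\ forall j, is_path A (p j),
    forall j, p j 0%N != 0 & forall j k r, (j < k < 3)%N ->
    ~ forall n, p k n = r * p j n].
Proof.
pose p (j n : nat) : R := match j, n with
  | 0%N, _ => 1 | 1%N, _ => 2^-1 ^+ n | _, 0%N => 3^-1 | _, _ => 1 end.
have h01 : 0 <= (2^-1 : R) <= 1 by lra.
have hn n : 0 <= (2^-1 : R) ^+ n <= 1.
  by rewrite exprn_ge0 ?exprn_ile1//; case/andP: h01.
exists p; split.
- move=> [|[|j]] n /=.
  + by split; [rewrite ler01 lexx|exists 1; rewrite ?mulr1].
  + by split => //; exists 2^-1; rewrite ?exprS.
  + case: n => [|n] /=; first by split; [lra|exists 3 => //; lra].
    by split; [rewrite ler01 lexx|exists 1; rewrite ?mulr1].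
- by move=> [|[|j]] /=; rewrite ?expr0 ?oner_eq0// invr_eq0.
- move=> j k r /andP[+ +] E; case: k E => [|[|[|k]]]// E; case: j E => [|[|j]]// E _ _.
  + by have := E 0%N; have := E 1%N; rewrite /= ?expr0 ?expr1; lra.
  + by have := E 0%N; have := E 1%N; rewrite /=; lra.
  + by have := E 0%N; have := E 1%N; rewrite /= ?expr0 ?expr1; lra.
Qed.

Theorem fwd_Lelek : Lelek_fan (fwd_space G).
Proof.
apply: (@orbit_space_Lelek _ _ _ (fun i : nat => i.+1) (@fwd_val R G) 0%N succn M
  (@fwd_I R G) fwd_mdistE fwd_w_fin nat_next_ind M_gt0 M1 fwd_next fwd_total).
  have [p [Pp p0 pp]] := three_paths.
  have [x xp] := choice (fun j => path_fwd (Pp j)).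
  exists (x 0%N), (x 1%N), (x 2%N); rewrite !xp; split; first by split.
  by split=> r _ E; [apply: (pp 0%N 1%N r)|apply: (pp 1%N 2%N r)|
    apply: (pp 0%N 2%N r)] => // n; rewrite -!xp E.
move=> x eps eps0.
have [N hN] := mdist_lt 0%N (@fwd_I R G) fwd_mdistE eps0.
have e2 : 0 < eps / 2 by lra.
have [y [i [Py yi xy]]] := path_hits_one M3 M1 M2 A_bounds N (fwd_path x) e2.
have [z zy] := path_fwd Py; exists z, i; split; last by rewrite zy.
by apply: hN => j jN; rewrite zy distrC xy// ltnW.
Qed.

Theorem bi_Lelek : Lelek_fan (bi_space G).
Proof.
apply: (@orbit_space_Lelek _ _ _ (fun i : int => `|i|%N) (@bi_val R G) 0 (+%R^~ 1) M
  (@bi_I R G) bi_mdistE bi_w_fin int_next_ind M_gt0 M1 bi_next bi_total).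
  have [p [Pp p0 pp]] := three_paths.
  have [x xp] := choice (fun j => path_bi 0 (Pp j)).
  have {}xp j n : x j n%:Z = p j n by rewrite -xp subr0.
  exists (x 0%N), (x 1%N), (x 2%N); rewrite !xp; split; first by split.
  by split=> r _ E; [apply: (pp 0%N 1%N r)|apply: (pp 1%N 2%N r)|
    apply: (pp 0%N 2%N r)] => // n; rewrite -!xp E.
move=> x eps eps0.
have [N hN] := mdist_lt 0 (@bi_I R G) bi_mdistE eps0.
have e2 : 0 < eps / 2 by lra.
(* Read from position -N on, the coordinates with |j| <= N become the times 0 to 2N of a one-sided
   path. *)
have [y [i [Py yi xy]]] :=
  path_hits_one M3 M1 M2 A_bounds (N + N)%N (bi_path x N) e2.
have [z zy] := path_bi N Py; exists z, (i%:Z - N%:Z); split; last by rewrite zy.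
apply: hN => j jN; have [n nN ->] : exists2 n : nat, (n <= N + N)%N & j = n%:Z - N%:Z :> int.
  by exists `|(j + N%:Z)%R|%N; lia.
by rewrite zy distrC xy.
Qed.

Lemma iter_fwd_shift (x : fwd_space G) j i :
  iter j (@fwd_shift R G) x i = x (j + i)%N.
Proof. by elim: j i => [|j IH] i //=; rewrite IH addnS. Qed.

Lemma iter_bi_shift (x : bi_space G) j i :
  iter j (@bi_shift R G) x i = x (j%:Z + i).
Proof.
elim: j i => [|j IH] i /=; first by rewrite add0r.
by rewrite IH -addn1 PoszD; congr (bi_val x _); lia.
Qed.

(** * The specification property of the shifts *)

Theorem fwd_specification : specification_property (@fwd_shift R G).
Proof.
split.
  split; first exact: (orbit_compact 0%N (@fwd_I R G) fwd_mdistE fwd_w_fin fwd_next fwd_total).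
  by apply: (@shift_continuous _ _ _ (fun i : nat => i.+1) (@fwd_val R G) 0%N succn
    (@fwd_I R G) fwd_mdistE).
move=> eps eps0; have e2 : 0 < eps / 2 by lra.
have [K hK] := mdist_lt 0%N (@fwd_I R G) fwd_mdistE eps0.
have [N hN] := path_specification M3 M1 M2 A_bounds e2.
exists (K + N).+1 => // n x k l [_ kl] gap.
(* Closeness at time [j] is a matter of the coordinates from [j] to [j + K], so each block is
   prolonged by [K]; gaps of at least [N] remain. *)
have [i|i|i|y Py ytr] := hN n x k (fun i => l i + K)%N.
- exact: fwd_path.
- by move=> /kl; lia.
- by move=> /gap; lia.
have [z zy] := path_fwd Py; exists z => i j i_n /andP[kj jl].
apply/ltW/hK => m mK; rewrite !iter_fwd_shift zy; apply: ytr => //; lia.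
Qed.

Theorem bi_specification : specification_property (@bi_shift R G).
Proof.
split.
  split; first exact: (orbit_compact 0 (@bi_I R G) bi_mdistE bi_w_fin bi_next bi_total).
  apply: (@shift_continuous _ _ _ (fun i : int => `|i|%N) (@bi_val R G) 0
    (+%R^~ 1) (@bi_I R G) bi_mdistE) => //.
  by move=> i /=; lia.
move=> eps eps0; have e2 : 0 < eps / 2 by lra.
have [K hK] := mdist_lt 0 (@bi_I R G) bi_mdistE eps0.
have [N hN] := path_specification M3 M1 M2 A_bounds e2.
exists (K + K + N).+1 => // n x k l [_ kl] gap.
(* Paths are read from position -K on, so the window from [j - K] to [j + K] becomes the times [j]
   to [j + 2K]; each block is therefore prolonged by 2K on the right only. *)
have [i|i|i|y Py ytr] :=
    hN n (fun i n => x i (n%:Z - K%:Z)) k (fun i => l i + (K + K))%N.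
- exact: bi_path.
- by move=> /kl; lia.
- by move=> /gap; lia.
have [z zy] := path_bi K Py; exists z => i j i_n /andP[kj jl].
apply/ltW/hK => m mK; rewrite !iter_bi_shift.
have [t tE] : exists t : nat, j%:Z + m = t%:Z - K%:Z :> int.
  by exists `|(j%:Z + m + K%:Z)%R|%N; lia.
by rewrite tE zy; apply: ytr => //; lia.
Qed.

End instances.

Theorem theorem5p18 (R : realType) (G : set (R * R)) (HG : calF G) :
  (homeomorphic_to_Lelek_fan (fwd_space G) /\
   homeomorphic_to_Lelek_fan (bi_space G)) /\
  (specification_property (@fwd_shift R G) /\
   specification_property (@bi_shift R G)).
Proof.
case: HG => A [s sE bounds] <-; rewrite sE in bounds *.
set M : seq R := [:: 3, 1, 2^-1 & s].
have M3 : 3 \in M by rewrite mem_head.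
have M1 : 1 \in M by rewrite in_cons mem_head orbT.
have M2 : 2^-1 \in M by rewrite !in_cons eqxx !orbT.
have M_bounds a : a \in M -> 3^-1 <= a <= 3 by move=> /bounds[].
(* Each space is itself a Lelek fan, so the identity is the required homeomorphism. *)
have self (X : metricType R) : Lelek_fan X -> homeomorphic_to_Lelek_fan X.
  move=> LX; exists X; split => //; exists id, id.
  by split=> // x; exact: cvg_id.
split; split.
- exact/self/fwd_Lelek.
- exact/self/bi_Lelek.
- exact: fwd_specification.
- exact: bi_specification.
Qed.
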